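(* Let $k$ be a finite field of characteristic $p$, $n\geq 1$, $G=\mathrm{GL}_n(k)$, and let $U$ be the subgroup of upper triangular unipotent matrices. Let $C$ be the representation of $G$ over $\overline{\mathbf F}_p$ induced from the trivial character of $U$, and $H=\mathrm{End}_G(C)$. Let $\mathcal E$ and $\mathcal B$ be the categories of representations of $G$, $\mathrm{Mod}$ the category of right $H$-modules, and $\mathbf F:\mathcal E\to \mathrm{Mod}$, $\mathbf T:\mathrm{Mod}\to\mathcal E$ the functors, all defined in the context. The following assertions are equivalent: (1) the functor $\mathbf F:\mathcal E\to\mathrm{Mod}$ is full; (2) the functor $\mathbf T:\mathrm{Mod}\to\mathcal E$ is exact; (3) the categories $\mathcal E$ and $\mathcal B$ coincide; (4) the left $H$-module $C$ is flat; (5) the left $H$-module $C$ is projective.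
   Context: $\overline{\mathbf F}_p$ is an algebraic closure of $k$. Representations are finite-dimensional over $\overline{\mathbf F}_p$. $C$ is the space of functions $G\to\overline{\mathbf F}_p$ invariant under left translations by $U$, with $G$ acting by right translations; it is a left $H$-module. $\mathcal E$ is the full subcategory of the category of representations of $G$ formed by the representations generated by their $U$-invariant vectors. $\mathcal B$ is the largest full subcategory of $\mathcal E$ stable under the contragredient $V\mapsto V^\vee=\mathrm{Hom}(V,\overline{\mathbf F}_p)$; equivalently, it consists of the representations isomorphic to the image of an element of $\mathrm{End}_G(C^b)$ for some integer $b\geq1$. $\mathrm{Mod}$ is the category of finitely generated right $H$-modules. $\mathbf F(V)=\mathrm{Hom}_G(C,V)$, which is identified with $V^U$ via $f\mapsto f(\mathbf 1_U)$ ($\mathbf 1_U$ the characteristic function of $U$), with $H$ acting on the right by precomposition. $\mathbf T(\mathfrak m)=\mathfrak m\otimes_H C$ is the left adjoint of $\mathbf F$. Exactness in $\mathcal E$ refers to kernels and images in $\mathcal E$: for a morphism $f$ in $\mathcal E$, its kernel in $\mathcal E$ is the subrepresentation generated by the $U$-invariant vectors of the usual kernel, and its image in $\mathcal E$ is the usual image. *)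

(* Defs.v *)
From HB Require Import structures.
From mathcomp Require Import all_boot all_order all_fingroup all_algebra.
From mathcomp Require Import ring_quotient generic_quotient.
From mathcomp Require Import boolp.
From mathcomp Require Import freeg.

Set Implicit Arguments.
Unset Strict Implicit.
Unset Printing Implicit Defensive.

Import GRing.Theory.
Local Open Scope ring_scope.
Local Open Scope quotient_scope.

(* Right R-modules are left modules over the converse ring R^c: for
   m : M with M : lmodType R^c, the product m.a is (a : R^c) *: m. *)

Section TensorProduct.
Variables (R : pzRingType) (M : lmodType R^c) (N : lmodType R).

Definition tensor_gen (m : M) (n : N) : {freeg (M * N)} :=
  Freeg [:: (1, (m, n))].

Variant tensor_rel : {freeg (M * N)} -> Prop :=
| TensorAddl m m' n :
    tensor_rel (tensor_gen (m + m') n - (tensor_gen m n + tensor_gen m' n))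
| TensorAddr m n n' :
    tensor_rel (tensor_gen m (n + n') - (tensor_gen m n + tensor_gen m n'))
| TensorBal m (a : R) n :
    tensor_rel (tensor_gen ((a : R^c) *: m) n - tensor_gen m (a *: n)).

(* M (x)_R N is the free abelian group on M x N modulo the subgroup generated
   by tensor_rel, i.e. the smallest one containing it; tensor_ideal is the
   membership predicate of that subgroup. *)
Definition tensor_ideal : pred {freeg (M * N)} := fun x =>
  `[< forall S : {pred {freeg (M * N)}}, zmod_closed S ->
      (forall y, tensor_rel y -> y \in S) -> x \in S >].

Fact tensor_ideal_zmod : zmod_closed tensor_ideal.
Proof.
split; first by apply/asboolP => S [].
move=> x y /asboolP Hx /asboolP Hy; apply/asboolP => S Sz Sr.
by apply: Sz.2; [exact: Hx | exact: Hy].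
Qed.

HB.instance Definition _ :=
  GRing.isZmodClosed.Build {freeg (M * N)} tensor_ideal tensor_ideal_zmod.

Definition tensor_zmodClosed :=
  GRing.ZmodClosed.clone {freeg (M * N)} tensor_ideal _.

Definition tensor := Quotient.quot tensor_zmodClosed.

HB.instance Definition _ := GRing.Zmodule.on tensor.
HB.instance Definition _ :
  ZmodQuotient _ (Quotient.equiv tensor_zmodClosed) 0 -%R +%R tensor :=
  ZmodQuotient.on tensor.

Definition pure_tensor (m : M) (n : N) : tensor := \pi_tensor (tensor_gen m n).

Fact tensor_rel_eq0 x : tensor_rel x -> \pi_tensor x = 0.
Proof.
move=> rx; rewrite -[RHS](raddf0 \pi_tensor); apply/eqP.
rewrite -Quotient.idealrBE subr0.
by apply/asboolP => S _; apply.
Qed.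

Lemma pure_tensorDl m m' n :
  pure_tensor (m + m') n = pure_tensor m n + pure_tensor m' n.
Proof.
apply/eqP; rewrite -subr_eq0 /pure_tensor -!raddfD -raddfB.
by apply/eqP/tensor_rel_eq0; constructor.
Qed.

Lemma pure_tensorDr m n n' :
  pure_tensor m (n + n') = pure_tensor m n + pure_tensor m n'.
Proof.
apply/eqP; rewrite -subr_eq0 /pure_tensor -!raddfD -raddfB.
by apply/eqP/tensor_rel_eq0; constructor.
Qed.

Lemma pure_tensor_bal m (a : R) n :
  pure_tensor ((a : R^c) *: m) n = pure_tensor m (a *: n).
Proof.
apply/eqP; rewrite -subr_eq0 /pure_tensor -raddfB.
by apply/eqP/tensor_rel_eq0; constructor.
Qed.

Lemma tensor_ind (P : tensor -> Prop) :
    (forall m n, P (pure_tensor m n)) -> P 0 ->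
    (forall x y, P x -> P y -> P (x - y)) -> forall x, P x.
Proof.
move=> Pp P0 PB x.
have PN y : P y -> P (- y) by rewrite -[- y]sub0r; apply: PB.
have PD y z : P y -> P z -> P (y + z).
  by move=> Py Pz; rewrite -[z]opprK; apply/PB/PN.
have PMn y k : P y -> P (y *+ k).
  by move=> Py; elim: k => [|k IHk]; rewrite ?mulr0n // mulrS; apply: PD.
rewrite -[x]reprK -[repr x]freeg_sumE raddf_sum.
elim/big_rec: _ => // z y _ Py; apply: PD => //.
set c := coeff _ _.
have -> : Freeg [:: (c, z)] = tensor_gen z.1 z.2 *~ c.
  by rewrite /tensor_gen -surjective_pairing freegU_mulz intz.
by case: c => k; rewrite ?NegzE ?mulrNz ?raddfN -pmulrn raddfMn; do ?apply: PN;
  apply/PMn/Pp.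
Qed.

(* The additive map sending m (x) n to phi m n. It is defined through a chosen
   representative of x, hence only meaningful when phi is balanced
   (tensor_liftE). *)
Definition tensor_lift (A : zmodType) (phi : M -> N -> A) (x : tensor) : A :=
  fglift (fun mn : M * N => phi mn.1 mn.2 : zmodule A) (repr x).

Definition balanced (A : zmodType) (phi : M -> N -> A) :=
  [/\ forall m m' n, phi (m + m') n = phi m n + phi m' n,
      forall m n n', phi m (n + n') = phi m n + phi m n'
    & forall m (a : R) n, phi ((a : R^c) *: m) n = phi m (a *: n)].

Section Lift.
Variables (A : zmodType) (phi : M -> N -> A) (phiP : balanced phi).

Let flift := fglift (fun mn : M * N => phi mn.1 mn.2 : zmodule A).

Fact tensor_lift_pi x : tensor_lift phi (\pi_tensor x) = flift x.
Proof.
rewrite /tensor_lift -/flift; apply/eqP; rewrite -subr_eq0.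
have fliftB : {morph flift : u v / u - v}.
  by move=> u v; exact: lift_is_additive.
have fliftU m n : flift (tensor_gen m n) = phi m n.
  by rewrite /flift liftU scale1r.
have flift0 : flift 0 = 0 by rewrite -(subrr 0) fliftB subrr.
have fliftD : {morph flift : u v / u + v}.
  move=> u v; rewrite -[v in LHS]opprK fliftB -[- v]sub0r fliftB flift0.
  by rewrite sub0r opprK.
rewrite -fliftB; have: repr (\pi_tensor x) - x \in tensor_ideal.
  by rewrite Quotient.idealrBE reprK.
case: phiP => D1 D2 B1.
move/asboolP/(_ [pred y | flift y == 0]); apply.
  split; first by rewrite inE flift0.
  by move=> u v; rewrite !inE fliftB => /eqP-> /eqP->; rewrite subrr.
by move=> _ []=> *; rewrite inE fliftB ?fliftD !fliftU ?(D1, D2, B1) subrr.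
Qed.

Lemma tensor_liftE m n : tensor_lift phi (pure_tensor m n) = phi m n.
Proof. by rewrite tensor_lift_pi /flift liftU scale1r. Qed.

Fact tensor_lift_additive : zmod_morphism (tensor_lift phi).
Proof.
move=> x y; rewrite -[x]reprK -[y]reprK -raddfB !tensor_lift_pi.
exact: (lift_is_additive (fun mn : M * N => phi mn.1 mn.2 : zmodule A)).
Qed.

End Lift.

Lemma tensor_ext (A : zmodType) (f g : tensor -> A) :
    zmod_morphism f -> zmod_morphism g ->
    (forall m n, f (pure_tensor m n) = g (pure_tensor m n)) -> f =1 g.
Proof.
move=> fB gB fg; apply: tensor_ind => //.
  by rewrite -(subrr 0) fB gB !subrr.
by move=> x y; rewrite fB gB => -> ->.
Qed.

End TensorProduct.

(* f (x) g; the underlying functions suffice for the definition, but it is only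
   meaningful for linear f and g (tensor_mapE). *)
Definition tensor_map (R : pzRingType) (M M' : lmodType R^c)
    (N N' : lmodType R) (f : M -> M') (g : N -> N') :
    tensor M N -> tensor M' N' :=
  tensor_lift (fun m n => pure_tensor (f m) (g n)).

Section TensorMap.
Variables (R : pzRingType) (M M' : lmodType R^c) (N N' : lmodType R).
Variables (f : {linear M -> M'}) (g : {linear N -> N'}).

Fact tensor_map_balanced :
  balanced (fun (m : M) (n : N) => pure_tensor (f m) (g n)).
Proof.
split=> [m m' n|m n n'|m a n]; first by rewrite linearD pure_tensorDl.
  by rewrite linearD pure_tensorDr.
by rewrite !linearZ pure_tensor_bal.
Qed.

Lemma tensor_mapE m n :
  tensor_map f g (pure_tensor m n) = pure_tensor (f m) (g n).
Proof. exact: (tensor_liftE tensor_map_balanced). Qed.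

Lemma tensor_map_additive : zmod_morphism (tensor_map f g).
Proof. exact: (tensor_lift_additive tensor_map_balanced). Qed.

End TensorMap.

Definition flat (R : pzRingType) (N : lmodType R) : Prop :=
  forall (M M' : lmodType R^c) (f : {linear M -> M'}),
    injective f -> injective (tensor_map f (@idfun N)).

Definition projective (R : pzRingType) (P : lmodType R) : Prop :=
  forall (M N : lmodType R) (g : {linear M -> N}) (f : {linear P -> N}),
    (forall y, exists x, g x = y) ->
    exists h : {linear P -> M}, forall x, g (h x) = f x.

Definition finitely_generated (R : pzRingType) (M : lmodType R) : Prop :=
  exists (d : nat) (e : 'I_d -> M),
    forall x, exists c : 'I_d -> R, x = \sum_i c i *: e i.

Lemma finitely_generated_fin (R : pzRingType) (M : lmodType R) (I : finType)
    (e : I -> M) :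
  (forall x, exists c : I -> R, x = \sum_i c i *: e i) -> finitely_generated M.
Proof.
move=> eP; exists #|I|, (fun i => e (enum_val i)) => x; have [c ->] := eP x.
exists (fun i => c (enum_val i)); rewrite (reindex (@enum_val I predT)) //.
exact: onW_bij (enum_val_bij _).
Qed.

Definition exact_mod (R : pzRingType) (L M N : lmodType R)
    (f : {linear L -> M}) (g : {linear M -> N}) : Prop :=
  forall y, g y = 0 <-> exists x, f x = y.

(* A vectType comes with coordinates, so those of a space that is only known to
   have a finite spanning family are picked by choice. *)
Section FinGenVect.
Variables (K : fieldType) (V : lmodType K).
Hypothesis Vfg : finitely_generated V.

Let spans d := `[< exists e : 'I_d -> V,
    forall x, exists c : 'I_d -> K, x = \sum_i c i *: e i >].

Fact fg_vect_axiom : {d : nat & Vector.axiom d V}.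
Proof.
have ex_d : exists d, spans d by case: Vfg => d de; exists d; apply/asboolP.
case: (ex_minnP ex_d) => d /asboolP/cid[e eP] d_min; exists d.
have free_e (c : 'I_d -> K) : \sum_i c i *: e i = 0 -> forall i, c i = 0.
  move=> ce0 i; apply: contrapT => /eqP ci_neq0.
  have d_gt0 : (0 < d)%N by case: (i) => k /(leq_ltn_trans _) -> //.
  suff : spans d.-1 by move/d_min; rewrite -ltnS prednK // ltnn.
  apply/asboolP; exists (fun j => e (fintype.lift i j)) => x.
  have [b ->] := eP x.
  have ei : e i = - \sum_(j < d.-1)
      ((c i)^-1 * c (fintype.lift i j)) *: e (fintype.lift i j).
    have := congr1 (fun y => (c i)^-1 *: y) ce0.
    rewrite scaler0 (bigD1_ord i) //= scalerDr scalerA mulVf // scale1r.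
    move/(canRL (addrK _)) => ->; rewrite sub0r scaler_sumr; congr (- _).
    by apply: eq_bigr => j _; rewrite scalerA.
  exists (fun j => b (fintype.lift i j) -
                   b i * ((c i)^-1 * c (fintype.lift i j))).
  rewrite (bigD1_ord i) //= ei scalerN scaler_sumr addrC -sumrB.
  by apply: eq_bigr => j _; rewrite scalerA scalerBl.
pose vv (v : V) : 'rV[K]_d := \row_j sval (cid (eP v)) j.
have vvK v : \sum_j vv v 0 j *: e j = v.
  by rewrite [RHS](svalP (cid (eP v))); apply: eq_bigr => j _; rewrite mxE.
have vvU v (r : 'rV[K]_d) : \sum_j r 0 j *: e j = v -> vv v = r.
  move=> rv; apply/rowP => j; apply/eqP; rewrite -subr_eq0; apply/eqP.
  apply: (free_e (fun j => vv v 0 j - r 0 j)).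
  under eq_bigr do rewrite scalerBl.
  by rewrite sumrB vvK rv subrr.
exists vv.
  move=> a u v; apply: vvU.
  rewrite -[u in RHS]vvK -[v in RHS]vvK scaler_sumr -big_split /=.
  by apply: eq_bigr => j _; rewrite !mxE scalerDl scalerA.
exists (fun r : 'rV[K]_d => \sum_j r 0 j *: e j) => [v|r]; first exact: vvK.
exact: vvU.
Qed.

End FinGenVect.

Section Representations.
Variables (K : fieldType) (gT : finGroupType).

Record rep := Rep {
  rep_sort :> vectType K;
  rep_act : gT -> 'End(rep_sort);
  rep_act1 : rep_act 1%g = \1%VF;
  rep_actM : forall g h, rep_act (g * h)%g = (rep_act g \o rep_act h)%VF
}.

Section Hom.
Variables V W : rep.

Definition intertwines (f : 'Hom(V, W)) : Prop :=
  forall g v, f (rep_act V g v) = rep_act W g (f v).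

Definition commutator_with (g : gT) (f : 'Hom(V, W)) : 'Hom(V, W) :=
  ((f \o rep_act V g) - (rep_act W g \o f))%VF.

Fact commutator_with_linear g : linear (commutator_with g).
Proof.
move=> a f f'; apply/lfunP => v; rewrite /commutator_with.
do !rewrite ?(add_lfunE, opp_lfunE, scale_lfunE, comp_lfunE)
  ?(linearD, linearZ) /=.
by rewrite addrACA.
Qed.

HB.instance Definition _ g :=
  GRing.isLinear.Build K 'Hom(V, W) 'Hom(V, W) _ (commutator_with g)
    (commutator_with_linear g).

Definition hom_space : {vspace 'Hom(V, W)} :=
  (\bigcap_(g : gT) lker (linfun (commutator_with g)))%VS.

Lemma hom_spaceP f : reflect (intertwines f) (f \in hom_space).
Proof.
apply: (iffP idP) => [fH g v|fH].
  have : f \in lker (linfun (commutator_with g)).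
    by apply: subvP fH; apply/bigcapv_inf.
  rewrite memv_ker lfunE /= /commutator_with => /eqP/lfunP/(_ v)/eqP.
  by rewrite add_lfunE opp_lfunE !comp_lfunE lfunE subr_eq0 => /eqP.
suff : (<[f]> <= hom_space)%VS by rewrite -memvE.
apply/subv_bigcapP => g _; rewrite -memvE memv_ker lfunE /=.
apply/eqP/lfunP => v; rewrite add_lfunE opp_lfunE !comp_lfunE lfunE /=.
by rewrite fH subrr.
Qed.

Definition homG := subvs_of hom_space.

Definition HomG (f : 'Hom(V, W)) (fP : intertwines f) : homG :=
  Subvs (introT (hom_spaceP f) fP).

Definition hom_lfun (f : homG) : 'Hom(V, W) := vsval f.

Lemma hom_intertwines (f : homG) : intertwines (hom_lfun f).
Proof. exact/hom_spaceP/subvsP. Qed.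

End Hom.

Coercion hom_lfun : homG >-> hom.

Lemma homG_eq (V W : rep) (f g : homG V W) : f =1 g -> f = g.
Proof. by move=> fg; apply/val_inj/lfunP. Qed.

Fact comp_intertwines (V W X : rep) (f : homG W X) (g : homG V W) :
  intertwines (f \o g)%VF.
Proof. by move=> a v; rewrite !comp_lfunE !hom_intertwines. Qed.

Definition comp_homG (V W X : rep) (f : homG W X) (g : homG V W) : homG V X :=
  HomG (comp_intertwines f g).

Fact id_intertwines (V : rep) : @intertwines V V \1%VF.
Proof. by move=> a v; rewrite !lfunE. Qed.

Definition id_homG (V : rep) : homG V V := HomG (@id_intertwines V).

Lemma comp_homGE (V W X : rep) (f : homG W X) (g : homG V W) v :
  comp_homG f g v = f (g v).
Proof. by rewrite /comp_homG /HomG /hom_lfun /= comp_lfunE. Qed.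

Lemma homG_addE (V W : rep) (f g : homG V W) v :
  (f + g : homG V W) v = f v + g v.
Proof. by rewrite /hom_lfun /= add_lfunE. Qed.

(* The product of endG V is composition, (f * g) v = f (g v). *)
Definition endG (V : rep) := homG V V.
Identity Coercion endG_homG : endG >-> homG.

Section EndRing.
Variable V : rep.

HB.instance Definition _ := GRing.Zmodule.on (endG V).

Fact endG_mulA : associative (@comp_homG V V V : endG V -> endG V -> endG V).
Proof. by move=> f g h; apply: homG_eq => v; rewrite !comp_homGE. Qed.

Fact endG_mul1 : left_id (id_homG V : endG V) (@comp_homG V V V).
Proof. by move=> f; apply: homG_eq => v; rewrite !comp_homGE lfunE. Qed.

Fact endG_mulr1 : right_id (id_homG V : endG V) (@comp_homG V V V).
Proof.
by move=> f; apply: homG_eq => v; rewrite !comp_homGE [id_homG V v]lfunE.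
Qed.

Fact endG_mulDl : left_distributive (@comp_homG V V V : endG V -> _ -> _) +%R.
Proof.
by move=> f g h; apply: homG_eq => v; rewrite !(homG_addE, comp_homGE).
Qed.

Fact endG_mulDr : right_distributive (@comp_homG V V V : endG V -> _ -> _) +%R.
Proof.
by move=> f g h; apply: homG_eq => v; rewrite !(homG_addE, comp_homGE) linearD.
Qed.

HB.instance Definition _ := GRing.Zmodule_isPzRing.Build (endG V)
  endG_mulA endG_mul1 endG_mulr1 endG_mulDl endG_mulDr.

End EndRing.

Section Dual.
Variable V : rep.

Definition dual_act_fun (g : gT) (phi : 'Hom(V, K^o)) : 'Hom(V, K^o) :=
  (phi \o rep_act V g^-1%g)%VF.

Fact dual_act_linear g : linear (dual_act_fun g).
Proof.
move=> a f f'; apply/lfunP => v.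
by rewrite !(add_lfunE, scale_lfunE, comp_lfunE).
Qed.

HB.instance Definition _ g := GRing.isLinear.Build K 'Hom(V, K^o) 'Hom(V, K^o) _
  (dual_act_fun g) (dual_act_linear g).

Definition dual_act g : 'End('Hom(V, K^o)) := linfun (dual_act_fun g).

Fact dual_act1 : dual_act 1%g = \1%VF.
Proof.
apply/lfunP => f; apply/lfunP => v.
by rewrite !lfunE /= invg1 rep_act1 lfunE.
Qed.

Fact dual_actM g h : dual_act (g * h)%g = (dual_act g \o dual_act h)%VF.
Proof.
apply/lfunP => f; apply/lfunP => v.
by rewrite comp_lfunE !lfunE /= !comp_lfunE invMg rep_actM comp_lfunE.
Qed.

Definition dual : rep := Rep dual_act1 dual_actM.

End Dual.

Definition generated_sub (V : rep) (X : {vspace V}) : {vspace V} :=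
  (\sum_(g : gT) (rep_act V g @: X))%VS.

(* In this section, with notation of the literature: the representation `ind` is
   the space C of functions f on gT such that f (u x) = f x for u in U, on which
   gT acts by right translations, and `hecke` is H = End_G(C). *)
Section Induction.
Variable U : {group gT}.

Definition invariants (V : rep) : {vspace V} :=
  (\bigcap_(u in U) fixedSpace (rep_act V u))%VS.

Lemma invariantsP (V : rep) (v : V) :
  reflect {in U, forall u, rep_act V u v = v} (v \in invariants V).
Proof.
rewrite memvE; apply: (iffP subv_bigcapP) => [vU u Uu|vU u Uu].
  by have := vU u Uu; rewrite -memvE => /fixedSpaceP.
by rewrite -memvE; apply/fixedSpaceP/vU.
Qed.

Definition ltrans (u : gT) (f : {ffun gT -> K^o}) : {ffun gT -> K^o} :=
  [ffun x => f (u * x)%g].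

Definition rtrans (g : gT) (f : {ffun gT -> K^o}) : {ffun gT -> K^o} :=
  [ffun x => f (x * g)%g].

Fact ltrans_linear u : linear (ltrans u).
Proof. by move=> a f f'; apply/ffunP => x; rewrite !ffunE. Qed.

HB.instance Definition _ u := GRing.isLinear.Build K
  {ffun gT -> K^o} {ffun gT -> K^o} _ (ltrans u) (ltrans_linear u).

Definition ind_space : {vspace {ffun gT -> K^o}} :=
  (\bigcap_(u in U) fixedSpace (linfun (ltrans u)))%VS.

Lemma ind_spaceP (f : {ffun gT -> K^o}) :
  reflect (forall u x, u \in U -> f (u * x)%g = f x) (f \in ind_space).
Proof.
rewrite memvE; apply: (iffP subv_bigcapP) => [fU u x Uu|fU u Uu].
  have := fU u Uu; rewrite -memvE => /fixedSpaceP; rewrite lfunE /=.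
  by move=> {2}<-; rewrite ffunE.
rewrite -memvE; apply/fixedSpaceP; rewrite lfunE /=.
by apply/ffunP => x; rewrite ffunE fU.
Qed.

Definition ind_sort := subvs_of ind_space.

Fact rtrans_ind g (c : ind_sort) : rtrans g (vsval c) \in ind_space.
Proof.
apply/ind_spaceP => u x Uu; rewrite !ffunE -mulgA.
by have /ind_spaceP cU := subvsP c; apply: cU.
Qed.

Definition ind_act_fun g (c : ind_sort) : ind_sort := Subvs (rtrans_ind g c).

Fact ind_act_linear g : linear (ind_act_fun g).
Proof.
by move=> a c d; apply/val_inj/ffunP => x; rewrite /= !ffunE.
Qed.

HB.instance Definition _ g := GRing.isLinear.Build K ind_sort ind_sort _
  (ind_act_fun g) (ind_act_linear g).

Definition ind_act g : 'End(ind_sort) := linfun (ind_act_fun g).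

Fact ind_act1 : ind_act 1%g = \1%VF.
Proof.
apply/lfunP => c; rewrite !lfunE /=; apply/val_inj/ffunP => x.
by rewrite ffunE mulg1.
Qed.

Fact ind_actM g h : ind_act (g * h)%g = (ind_act g \o ind_act h)%VF.
Proof.
apply/lfunP => c; rewrite comp_lfunE !lfunE /=; apply/val_inj/ffunP => x.
by rewrite !ffunE mulgA.
Qed.

Definition ind : rep := Rep ind_act1 ind_actM.

Definition charfun_fun : {ffun gT -> K^o} := [ffun x => (x \in U)%:R].

Fact charfun_ind : charfun_fun \in ind_space.
Proof. by apply/ind_spaceP => u x Uu; rewrite !ffunE groupMl. Qed.

Definition charfun : ind_sort := Subvs charfun_ind.

Lemma charfun_invariant : {in U, forall u, ind_act u charfun = charfun}.
Proof.
move=> u Uu; rewrite lfunE; apply/val_inj/ffunP => x.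
by rewrite /= !ffunE groupMr.
Qed.

Lemma ind_decomp (c : ind_sort) :
  c = \sum_(y | y == fingroup.repr (U :* y)%g)
        vsval c y *: ind_act y^-1%g charfun.
Proof.
have /ind_spaceP cU := subvsP c.
apply/val_inj/ffunP => x; rewrite [in RHS]linear_sum sum_ffunE.
have rK y : fingroup.repr (U :* fingroup.repr (U :* y))%g =
    fingroup.repr (U :* y)%g by rewrite rcoset_repr.
rewrite (bigD1 (fingroup.repr (U :* x)%g)) ?rK //= big1 => [|y]; last first.
  move=> /andP[/eqP yE yx]; rewrite lfunE !ffunE.
  case: (boolP (_ \in _)) => [|_]; last by rewrite scaler0.
  rewrite -mem_rcoset => /rcoset_eqP Uxy.
  by rewrite yE -Uxy eqxx in yx.
rewrite addr0 lfunE !ffunE; case: repr_rcosetP => u Uu.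
by rewrite invMg mulgA mulgV mul1g groupV Uu cU // /GRing.scale /= mulr1.
Qed.

Definition hecke := endG ind.
Identity Coercion hecke_endG : hecke >-> endG.
HB.instance Definition _ := GRing.PzRing.on hecke.

(* The space underlying `ind` carries two module structures: ind_sort is it as a
   vector space over K, and ind_mod is it as a left H-module. *)
Definition ind_mod := ind_sort.
HB.instance Definition _ := GRing.Zmodule.on ind_mod.

Definition hscale (h : hecke) (c : ind_mod) : ind_mod := hom_lfun h c.

Fact ind_scaleA (a b : hecke) c : hscale a (hscale b c) = hscale (a * b) c.
Proof. by rewrite /hscale [RHS]comp_homGE. Qed.

Fact ind_scale1 : left_id (1 : hecke) hscale.
Proof. by move=> c; rewrite /hscale [LHS]lfunE. Qed.

Fact ind_scaleDr : right_distributive hscale +%R.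
Proof. by move=> a c d; rewrite /hscale [LHS]linearD. Qed.

Fact ind_scaleDl c : {morph hscale^~ c : a b / a + b}.
Proof. by move=> a b; rewrite /hscale [LHS]homG_addE. Qed.

HB.instance Definition _ := GRing.Zmodule_isLmodule.Build hecke ind_mod
  ind_scaleA ind_scale1 ind_scaleDr ind_scaleDl.

Record fgmod := FgMod {
  fg_sort :> lmodType hecke^c;
  fg_finite : finitely_generated fg_sort
}.

Definition U_generated (V : rep) : Prop :=
  generated_sub (invariants V) = fullv.

Record objE := ObjE {
  E_rep :> rep;
  E_generated : U_generated E_rep
}.

(* B, the largest full subcategory of E stable under the contragredient, is the
   union of all the classes of objects P of E that are stable under it. *)
Definition in_B (V : rep) : Prop :=
  exists P : rep -> Prop,
    [/\ forall W, P W -> U_generated W, forall W, P W -> P (dual W) & P V].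

(* Kernels in E are not the usual ones: ker_E f is the largest subobject of
   lker f that belongs to E. *)
Definition ker_E (V W : rep) (f : homG V W) : {vspace V} :=
  generated_sub (lker f :&: invariants V)%VS.

Definition im_E (V W : rep) (f : homG V W) : {vspace W} := limg f.

Definition exact_E (V W X : rep) (f : homG V W) (g : homG W X) : Prop :=
  im_E f = ker_E g.

Section F.
Variable V : rep.

(* Hom_G(C, V), on which H acts on the right by precomposition. *)
Definition F_sort := homG ind V.
Identity Coercion F_sort_homG : F_sort >-> homG.
HB.instance Definition _ := GRing.Zmodule.on F_sort.

Definition F_scale (h : hecke^c) (f : F_sort) : F_sort :=
  comp_homG f (h : hecke).

Fact F_scaleA a b f : F_scale a (F_scale b f) = F_scale (a * b) f.
Proof.
apply: homG_eq => c; rewrite /F_scale !comp_homGE; congr ((f : homG ind V) _).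
Qed.

Fact F_scale1 : left_id 1 F_scale.
Proof.
move=> f; apply: homG_eq => c.
by rewrite /F_scale comp_homGE [(1 : hecke) c]lfunE.
Qed.

Fact F_scaleDr : right_distributive F_scale +%R.
Proof.
move=> a f g; apply: homG_eq => c.
by rewrite [LHS]comp_homGE [LHS]homG_addE [RHS]homG_addE /F_scale !comp_homGE.
Qed.

Fact F_scaleDl f : {morph F_scale^~ f : a b / a + b}.
Proof.
move=> a b; apply: homG_eq => c.
rewrite [LHS]comp_homGE homG_addE [LHS]linearD [RHS]homG_addE.
by rewrite /F_scale !comp_homGE.
Qed.

HB.instance Definition _ := GRing.Zmodule_isLmodule.Build hecke^c F_sort
  F_scaleA F_scale1 F_scaleDr F_scaleDl.

Fact F_finite : finitely_generated F_sort.
Proof.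
set b := vbasis {: homG ind V}.
exists (\dim {: homG ind V}), (fun i => b`_i : F_sort) => f.
exists (fun i => coord b i (f : homG ind V) *: id_homG ind : homG ind ind).
rewrite {1}(coord_vbasis (memvf (f : homG ind V))).
apply: eq_bigr => i _; apply: homG_eq => c.
rewrite [RHS]comp_homGE /hom_lfun /= !scale_lfunE lfunE /=.
by rewrite linearZ.
Qed.

End F.

Definition F_obj (V : objE) : fgmod := FgMod (F_finite V).

Definition F_map (V W : objE) (f : homG V W) (x : F_obj V) : F_obj W :=
  comp_homG f (x : homG ind V).

Fact F_map_linear (V W : objE) (f : homG V W) : linear (F_map f).
Proof.
move=> a x y; apply: homG_eq => c.
by rewrite /F_map !(comp_homGE, homG_addE) linearD.
Qed.

HB.instance Definition _ (V W : objE) (f : homG V W) :=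
  GRing.isLinear.Build hecke^c (F_obj V) (F_obj W) _ (F_map f) (F_map_linear f).

Definition F_full : Prop :=
  forall (V W : objE) (phi : {linear F_obj V -> F_obj W}),
    exists f : homG V W, forall x, phi x = F_map f x.

Definition ind_scale (a : K) (c : ind_mod) : ind_mod := a *: (c : ind_sort).
Definition ind_trans (g : gT) (c : ind_mod) : ind_mod := ind_act g c.

Fact ind_scale_linear a : linear (ind_scale a).
Proof.
move=> h c d; rewrite /ind_scale [LHS]scalerDr; congr (_ + _).
by rewrite -[LHS]linearZ.
Qed.

Fact ind_trans_linear g : linear (ind_trans g).
Proof.
move=> h c d; rewrite /ind_trans [LHS]linearD; congr (_ + _).
by rewrite -[LHS](hom_intertwines (h : hecke)).
Qed.

HB.instance Definition _ a :=
  GRing.isLinear.Build hecke ind_mod ind_mod _ (ind_scale a)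
    (ind_scale_linear a).
HB.instance Definition _ g :=
  GRing.isLinear.Build hecke ind_mod ind_mod _ (ind_trans g)
    (ind_trans_linear g).

Section T.
Variable m : fgmod.

(* m (x)_H C, on which K and gT act through C. *)
Definition T_sort := tensor m ind_mod.
HB.instance Definition _ := GRing.Zmodule.on T_sort.

Definition T_scale (a : K) : T_sort -> T_sort :=
  tensor_map (@idfun m) (ind_scale a).

Lemma T_scaleE a (x : m) c :
  T_scale a (pure_tensor x c) = pure_tensor x (ind_scale a c).
Proof. exact: tensor_mapE. Qed.

Fact T_scaleDr : right_distributive T_scale +%R.
Proof.
move=> a; pose f : {additive T_sort -> T_sort} := HB.pack (T_scale a)
  (GRing.isZmodMorphism.Build _ _ _
    (tensor_map_additive (@idfun m) (ind_scale a))).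
exact: (raddfD f).
Qed.

Fact T_scale_additive a : zmod_morphism (T_scale a).
Proof. exact: tensor_map_additive. Qed.

Fact T_scaleA a b x : T_scale a (T_scale b x) = T_scale (a * b) x.
Proof.
apply: (tensor_ext (f := T_scale a \o T_scale b)) x; last 1 first.
- by move=> x c; rewrite /= !T_scaleE /ind_scale scalerA.
- by move=> x y; rewrite /= !T_scale_additive.
- exact: T_scale_additive.
Qed.

Fact T_scale1 : left_id 1 T_scale.
Proof.
move=> x; apply: (tensor_ext (f := T_scale 1) (g := id)) x => //.
  exact: T_scale_additive.
by move=> x c; rewrite T_scaleE /ind_scale scale1r.
Qed.

Fact T_scaleDl x : {morph T_scale^~ x : a b / a + b}.
Proof.
move=> a b.
apply: (tensor_ext (f := T_scale (a + b))
  (g := fun x => T_scale a x + T_scale b x)) x.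
- exact: T_scale_additive.
- by move=> x y; rewrite !T_scale_additive addrACA opprD.
- by move=> x c; rewrite !T_scaleE -pure_tensorDr /ind_scale scalerDl.
Qed.

HB.instance Definition _ := GRing.Zmodule_isLmodule.Build K T_sort
  T_scaleA T_scale1 T_scaleDr T_scaleDl.

Lemma pure_tensor_sumr (I : finType) (x : m) (c : I -> ind_mod) :
  pure_tensor x (\sum_i c i) = \sum_i pure_tensor x (c i) :> T_sort.
Proof.
apply: (big_morph (pure_tensor x) (pure_tensorDr x)).
by apply: (addrI (pure_tensor x 0)); rewrite -pure_tensorDr !addr0.
Qed.

Lemma pure_tensor_suml (I : finType) (x : I -> m) (c : ind_mod) :
  pure_tensor (\sum_i x i) c = \sum_i pure_tensor (x i) c :> T_sort.
Proof.
apply: (big_morph (fun x : m => pure_tensor x c : T_sort)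
  (fun x y => pure_tensorDl x y c)).
by apply: (addrI (pure_tensor 0 c)); rewrite -pure_tensorDl !addr0.
Qed.

Fact T_fg : finitely_generated (T_sort : lmodType K).
Proof.
have [d [e eP]] := fg_finite m.
pose r : nat := \dim {: ind_sort}.
pose b : r.-tuple ind_sort := vbasis {: ind_sort}.
pose B (k : 'I_d * 'I_r) : T_sort := pure_tensor (e k.1) (b`_k.2 : ind_mod).
apply: (finitely_generated_fin (e := B)); apply: tensor_ind.
- move=> x c; have [h ->] := eP x.
  pose a i j : K := coord b j ((h i : hecke) *: (c : ind_mod) : ind_sort).
  exists (fun k => a k.1 k.2).
  rewrite -(pair_bigA _ (fun i j => a i j *: B (i, j))) /=.
  rewrite pure_tensor_suml; apply: eq_bigr => i _.
  rewrite pure_tensor_bal.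
  rewrite [(h i : hecke) *: c in LHS](coord_vbasis (memvf (_ : ind_sort))).
  rewrite pure_tensor_sumr; apply: eq_bigr => j _.
  by rewrite -[LHS]T_scaleE.
- by exists (fun=> 0); rewrite big1 // => k _; rewrite scale0r.
- move=> x y [cx ->] [cy ->]; exists (fun k => cx k - cy k).
  by rewrite -sumrB; apply: eq_bigr => k _; rewrite scalerBl.
Qed.

HB.instance Definition _ :=
  Lmodule_hasFinDim.Build K T_sort (projT2 (fg_vect_axiom T_fg)).

Definition T_act_fun (g : gT) : T_sort -> T_sort :=
  tensor_map (@idfun m) (ind_trans g).

Lemma T_act_funE g (x : m) c :
  T_act_fun g (pure_tensor x c) = pure_tensor x (ind_trans g c).
Proof. exact: tensor_mapE. Qed.

Lemma T_act_fun_additive g : zmod_morphism (T_act_fun g).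
Proof. exact: tensor_map_additive. Qed.

Fact T_act_linear g : linear (T_act_fun g).
Proof.
have AB := T_act_fun_additive g.
have AN y : T_act_fun g (- y) = - T_act_fun g y.
  by rewrite -sub0r AB -{1}(subrr 0) AB subrr sub0r.
move=> a x y; rewrite -[y in LHS]opprK AB AN opprK; congr (_ + _).
apply: (tensor_ext (f := fun z => T_act_fun g (a *: (z : T_sort)))
  (g := fun z => a *: T_act_fun g z)) x.
- by move=> u v; rewrite scalerBr AB.
- by move=> u v; rewrite AB scalerBr.
move=> x c; rewrite [a *: _]T_scaleE !T_act_funE [RHS]T_scaleE.
by congr pure_tensor; rewrite /ind_trans /ind_scale linearZ.
Qed.

HB.instance Definition _ g :=
  GRing.isLinear.Build K T_sort T_sort _ (T_act_fun g) (T_act_linear g).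

Definition T_act (g : gT) : 'End(T_sort) := linfun (T_act_fun g).

Fact T_act1 : T_act 1%g = \1%VF.
Proof.
apply/lfunP => x; rewrite !lfunE /=.
apply: (tensor_ext (f := T_act_fun 1%g) (g := id)) x => //.
  exact: T_act_fun_additive.
by move=> x c; rewrite T_act_funE /ind_trans ind_act1 lfunE.
Qed.

Fact T_actM g h : T_act (g * h)%g = (T_act g \o T_act h)%VF.
Proof.
apply/lfunP => x; rewrite comp_lfunE !lfunE /=.
apply: (tensor_ext (f := T_act_fun (g * h)%g)
  (g := T_act_fun g \o T_act_fun h)) x.
- exact: T_act_fun_additive.
- by move=> x y; rewrite /= !T_act_fun_additive.
by move=> x c; rewrite /= !T_act_funE /ind_trans ind_actM comp_lfunE.
Qed.

Definition T_rep : rep := Rep T_act1 T_actM.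

Lemma T_repE g (x : m) (c : ind_mod) :
  rep_act T_rep g (pure_tensor x c : T_sort) = pure_tensor x (ind_trans g c).
Proof. by rewrite [LHS]lfunE [LHS]T_act_funE. Qed.

Fact T_generated : U_generated T_rep.
Proof.
apply/vspaceP => x; rewrite memvf; move: x.
apply: tensor_ind => [x c|/=|x y Hx Hy]; last 2 first.
- exact: mem0v.
- exact: (memvB (Hx : (x : T_rep) \in _) Hy).
rewrite (ind_decomp c) big_mkcond pure_tensor_sumr.
apply: memv_suml => g _; case: ifP => _; last first.
  have -> : pure_tensor x 0 = 0 :> T_sort; last exact: mem0v.
  by apply: (addrI (pure_tensor x 0)); rewrite -pure_tensorDr !addr0.
have -> : pure_tensor x (vsval c g *: ind_act g^-1%g charfun : ind_mod) =
    vsval c g *: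
      rep_act T_rep g^-1%g (pure_tensor x (charfun : ind_mod) : T_sort).
  by rewrite T_repE [RHS]T_scaleE.
apply/memvZ/(subvP (sumv_sup g^-1%g _ (subvv _))) => //.
apply: memv_img; apply/invariantsP => u Uu.
by rewrite T_repE /ind_trans charfun_invariant.
Qed.

Definition T_obj : objE := ObjE T_generated.

End T.

Section TMap.
Variables (m m' : fgmod) (f : {linear m -> m'}).

Definition T_map_fun : T_rep m -> T_rep m' := tensor_map f (@idfun ind_mod).

Lemma T_map_funE (x : m) c :
  T_map_fun (pure_tensor x c) = pure_tensor (f x) c.
Proof. exact: tensor_mapE. Qed.

Fact T_map_fun_additive : zmod_morphism T_map_fun.
Proof. exact: tensor_map_additive. Qed.

Fact T_map_fun_linear : linear T_map_fun.
Proof.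
have AB := T_map_fun_additive.
have AN y : T_map_fun (- y) = - T_map_fun y.
  by rewrite -sub0r AB -{1}(subrr 0) AB subrr sub0r.
move=> a x y; rewrite -[y in LHS]opprK AB AN opprK; congr (_ + _).
apply: (tensor_ext (f := fun z => T_map_fun (a *: (z : T_sort m)))
  (g := fun z => a *: T_map_fun z)) x.
- by move=> u v; rewrite scalerBr AB.
- by move=> u v; rewrite AB scalerBr.
by move=> x c; rewrite [a *: _]T_scaleE !T_map_funE [RHS]T_scaleE.
Qed.

HB.instance Definition _ :=
  GRing.isLinear.Build K (T_rep m) (T_rep m') _ T_map_fun T_map_fun_linear.

Fact T_map_intertwines :
  intertwines (V := T_rep m) (W := T_rep m') (linfun T_map_fun).
Proof.
move=> g x; rewrite !lfunE /=.
apply: (tensor_ext (f := T_map_fun \o T_act_fun g)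
  (g := T_act_fun g \o T_map_fun)) x.
- by move=> x y; rewrite /= T_act_fun_additive T_map_fun_additive.
- by move=> x y; rewrite /= T_map_fun_additive T_act_fun_additive.
by move=> x c; rewrite /= T_map_funE !T_act_funE T_map_funE.
Qed.

Definition T_map : homG (T_obj m) (T_obj m') := HomG T_map_intertwines.

End TMap.

Definition T_exact : Prop :=
  forall (L M N : fgmod) (f : {linear L -> M}) (g : {linear M -> N}),
    exact_mod f g -> exact_E (T_map f) (T_map g).

Definition E_eq_B : Prop := forall V : rep, U_generated V <-> in_B V.

End Induction.
End Representations.

Section Unitriangular.
Variables (n : nat) (k : finFieldType).

Definition unitri : {set {'GL_n[k]}} :=
  [set g : {'GL_n[k]} | [forall i : 'I_n.-1.+1, forall j : 'I_n.-1.+1,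
    (j <= i)%N ==> (GLval g i j == (i == j)%:R)]].

Fact unitri_group_set : group_set unitri.
Proof.
have unitriP g : reflect (forall i j : 'I_n.-1.+1, (j <= i)%N ->
    GLval g i j = (i == j)%:R) (g \in unitri).
  rewrite inE; apply: (iffP forallP) => gU i.
    by move=> j ji; have /forallP/(_ j)/implyP/(_ ji)/eqP := gU i.
  by apply/forallP => j; apply/implyP => ji; apply/eqP/gU.
apply/group_setP; split=> [|g h /unitriP gU /unitriP hU].
  by apply/unitriP => i j _; rewrite GL_1E mxE.
apply/unitriP => i j ji; rewrite GL_MxE mxE (bigD1 i) //= big1 => [|l li].
  by rewrite addr0 gU // eqxx mul1r hU.
have [le_li|lt_il] := leqP l i.
  by rewrite gU // eq_sym (negPf li) mul0r.
rewrite (hU l j) ?(leq_trans ji (ltnW lt_il)) //.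
have -> : (l == j) = false; last by rewrite mulr0.
by apply/negP => /eqP lj; move: ji; rewrite -lj leqNgt lt_il.
Qed.

Canonical unitri_group := Group unitri_group_set.

End Unitriangular.

(* Main.v *)
Require Import Defs.
From HB Require Import structures.
From mathcomp Require Import all_boot all_order all_fingroup all_algebra.
From mathcomp Require Import all_solvable all_character.
From mathcomp Require Import boolp.

Set Implicit Arguments.
Unset Strict Implicit.
Unset Printing Implicit Defensive.

Import GRing.Theory.
Local Open Scope ring_scope.

(** Two facts about G = GL_n(k) carry the theorem; the rest is formal.

    First, U is a p-group and K has characteristic p, so that a nonzero
    representation has nonzero U-invariants ([pgroup_invariants]).

    Secondly, H is a Frobenius algebra. Let w be the antidiagonal permutation
    matrix. The linear form tau sending h to the value at w of the function
    h (1_U) makes (h', h) |-> tau (h' h) nondegenerate ([criterion_frobenius]).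
    An element h of H is a function f on G that is invariant under U on both
    sides, and its translate x |-> f (x w) is invariant under U on the left and
    under the lower unipotent subgroup U^- on the right. The numbers tau (h' h)
    include the sums of this translate over the sets U \ U x U. By the Birkhoff
    decomposition ([birkhoff]) its support contains monomial matrices, and for
    a maximal one among them, x say, the only term of the sum over U \ U x U
    that survives is the one at x ([unitri_criterion]).

    Through tau, the K-linear functionals on a finitely generated right
    H-module m are the same as the H-linear maps from m to H ([coinduction]).
    Call V separated when the G-maps from V to C have no common zero but 0. By
    duality this means that the contragredient of V belongs to E, so E = B says
    that all objects of E are separated. If V is separated, every H-linear map
    from F(V) to H = F(C) comes from a G-map from V to C
    ([separated_hom_lift]): otherwise some nonzero x in F(V) would have
    tau (theta x) = 0 for all theta : V -> C, hence theta x = 0 for all theta.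
    The unit from m to F(T(m)) is always injective, because the H-linear maps
    from m to H separate points, and it is bijective as soon as T(m) is
    separated, because those from F(T(m)) to H then come from T(m).

    If F is full then all objects of E are separated, as the H-linear maps from
    F(V) to H separate points. If they are all separated then T is exact, since
    the units are bijective. Exactness of T, applied to injections, says that
    tensoring with C preserves injections of finitely generated modules. From that
    restricted flatness one gets, on one hand, that T(m) is separated, by
    embedding m in some H^b and so T(m) in C^b; then the kernel of the counit
    from T(F(V)) to V has no U-invariants, the counit is an isomorphism, and F
    is full. On the other hand, for m the linear dual of C, the evaluation
    pairing from T(m) to K extends to C^b, and this extension amounts to a dual
    basis of C ([fg_flat_dual_basis]), so C is projective and flat. *)

(** * Functionals and pairings on finite-dimensional spaces *)

Lemma linear_pack (R : pzRingType) (M N : lmodType R) (f : M -> N) :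
  linear f -> {F : {linear M -> N} | F =1 f}.
Proof.
move=> fL; pose F : {linear M -> N} :=
  HB.pack f (GRing.isLinear.Build _ _ _ _ f fL).
by exists F.
Qed.

Section Pairings.
Variable K : fieldType.

Lemma hom_pack (V W : vectType K) (f : V -> W) :
  linear f -> {F : 'Hom(V, W) | F =1 f}.
Proof.
by move=> /linear_pack[F fE]; exists (linfun F) => v; rewrite lfunE fE.
Qed.

Lemma scalar0 (V : lmodType K) (f : V -> K) : scalar f -> f 0 = 0.
Proof. by move=> /(@linear_pack K V K^o)[F FE]; rewrite -FE linear0. Qed.

(** The vectors of B embed in K^(dim A) through beta and a basis of A; a linear
    form on B extends to K^(dim A), where it is a combination of coordinates. *)
Lemma pairing_surj (A B : vectType K) (beta : A -> B -> K) (lam : B -> K^o) :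
    (forall b, scalar (beta^~ b)) -> (forall a, scalar (beta a)) ->
    (forall b, (forall a, beta a b = 0) -> b = 0) ->
  scalar lam -> exists a, lam =1 beta a.
Proof.
move=> betal betar nondeg lamL.
pose e := vbasis {: A}.
have sumB (d : nat) (c : 'I_d -> K) (a : 'I_d -> A) b :
    beta (\sum_i c i *: a i) b = \sum_i c i * beta (a i) b.
  have [G GE] := @linear_pack K A K^o (beta^~ b) (betal b).
  rewrite -[LHS](GE _) linear_sum; apply: eq_bigr => i _.
  by rewrite linearZ /= GE.
have [|J JE] := @hom_pack B 'rV[K]_(\dim {: A}) (fun b => \row_k beta e`_k b).
  by move=> c u v; apply/rowP => k; rewrite !mxE betar.
have [L LE] := @hom_pack B K^o lam lamL.
have J0 : lker J == 0%VS.
  apply/eqP/vspaceP => b; rewrite memv_ker memv0 JE.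
  apply/eqP/eqP => [b0|->]; last first.
    by apply/rowP => k; rewrite !mxE scalar0.
  apply: nondeg => a; rewrite (coord_vbasis (memvf a)) sumB big1 // => i _.
  by move/rowP/(_ i): b0; rewrite !mxE => ->; rewrite mulr0.
exists (\sum_i L (J^-1%VF (delta_mx 0 i)) *: e`_i) => b.
rewrite sumB -LE -{1}(lker0_lfunK J0 b) [J b]row_sum_delta !linear_sum.
apply: eq_bigr => i _; rewrite !linearZ /= mulrC; congr (_ * _).
by rewrite JE mxE.
Qed.

(** The map from A to its dual is surjective by [pairing_surj], hence injective
    by equality of dimensions. *)
Lemma pairing_nondegC (A : vectType K) (beta : A -> A -> K) :
    (forall b, scalar (beta^~ b)) -> (forall a, scalar (beta a)) ->
    (forall b, (forall a, beta a b = 0) -> b = 0) ->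
  forall a, (forall b, beta a b = 0) -> a = 0.
Proof.
move=> betal betar nondeg.
have adj a := @hom_pack A K^o (beta a) (betar a).
have [|P PE] := @hom_pack A 'Hom(A, K^o) (fun a => sval (adj a)).
  move=> c u v; apply/lfunP => b; rewrite add_lfunE scale_lfunE.
  by do 3!case: (adj _) => ? /= ->; rewrite betal.
have Psurj : limg P = fullv.
  apply/vspaceP => l; rewrite memvf.
  have [a aE] := @pairing_surj A A beta l betal betar nondeg (linearP l).
  have -> : l = P a.
    by apply/lfunP => b; rewrite PE aE; case: (adj a) => ? /= ->.
  exact: memv_img (memvf _).
have := limg_ker_dim P fullv; rewrite Psurj !dimvf capfv.
rewrite /dim /= /dim /= muln1.
move/eqP; rewrite -[X in _ == X]add0n eqn_add2r dimv_eq0 => /eqP P0 a a0.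
apply/eqP; rewrite -memv0 -P0 memv_ker; apply/eqP/lfunP => b.
by rewrite PE zero_lfunE; case: (adj a) => ? /= ->.
Qed.

Lemma functionals_separate (V : vectType K) (v : V) :
  (forall l : 'Hom(V, K^o), l v = 0) -> v = 0.
Proof.
move=> v0; rewrite (coord_vbasis (memvf v)) big1 // => i _.
have [|l lE] := @hom_pack V K^o (coord (vbasis {: V}) i); first exact: linearP.
by rewrite -lE v0 scale0r.
Qed.

Lemma functionals_detect_subspace (V : vectType K) (X : {vspace V}) v :
  (forall l : 'Hom(V, K^o), (forall x, x \in X -> l x = 0) -> l v = 0) ->
  v \in X.
Proof.
move=> vX; suff -> : v = projv X v by exact: memv_proj.
apply/eqP; rewrite -subr_eq0; apply/eqP/functionals_separate => l.
have := vX (l \o (\1 - projv X))%VF.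
rewrite comp_lfunE add_lfunE opp_lfunE id_lfunE; apply => x xX.
by rewrite comp_lfunE add_lfunE opp_lfunE id_lfunE projv_id // subrr linear0.
Qed.

End Pairings.

(** * Dual bases, projective and flat modules *)
Lemma finitely_generated_ffun (R : pzRingType) (N : lmodType R) (b : nat) :
  finitely_generated N -> @finitely_generated R {ffun 'I_b -> N}.
Proof.
move=> [d [e eP]].
apply: (@finitely_generated_fin R {ffun 'I_b -> N} ('I_b * 'I_d)%type
  (fun k => [ffun i => if i == k.1 then e k.2 else 0])) => x.
exists (fun k => sval (cid (eP (x k.1))) k.2); apply/ffunP => i.
rewrite sum_ffunE -(pair_bigA _ (fun k j => (sval (cid (eP (x k))) j *:
  [ffun i => if i == k then e j else 0]) i)) /=.
rewrite (bigD1 i) //= [X in _ + X]big1 => [|k /negPf ki].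
  rewrite addr0 {1}(svalP (cid (eP (x i)))); apply: eq_bigr => j _.
  by rewrite !ffunE eqxx.
by rewrite big1 // => j _; rewrite !ffunE eq_sym ki scaler0.
Qed.

Lemma pure_tensor0l (R : pzRingType) (M : lmodType R^c) (N : lmodType R)
    (y : N) :
  pure_tensor (0 : M) y = 0.
Proof. by apply: (addrI (pure_tensor 0 y)); rewrite -pure_tensorDl !addr0. Qed.

Section DualBasis.
Variables (R : pzRingType) (N : lmodType R).

Definition has_dual_basis : Prop :=
  exists (d : nat) (e : 'I_d -> N) (s : 'I_d -> {linear N -> R^o}),
    forall y, y = \sum_i (s i y : R) *: e i.

Lemma dual_basis_projective : has_dual_basis -> projective N.
Proof.
move=> [d [e [s sE]]] M L g f gS.
pose x i := sval (cid (gS (f (e i)))).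
have [|h hE] := @linear_pack R N M (fun y => \sum_i (s i y : R) *: x i).
  move=> a y z; rewrite scaler_sumr -big_split; apply: eq_bigr => i _ /=.
  by rewrite linearP scalerDl scalerA.
exists h => y; rewrite hE [in RHS](sE y) !linear_sum; apply: eq_bigr => i _.
by rewrite !linearZ /= (svalP (cid (gS (f (e i))))).
Qed.

Lemma projective_dual_basis :
  finitely_generated N -> projective N -> has_dual_basis.
Proof.
move=> [d [e eP]] projN.
have [|g gE] := @linear_pack R {ffun 'I_d -> R^o} N
    (fun c => \sum_i (c i : R) *: e i).
  move=> a y z; rewrite scaler_sumr -big_split; apply: eq_bigr => i _ /=.
  by rewrite !ffunE scalerDl scalerA.
have [|id idE] := @linear_pack R N N id; first by [].
have [|h hE] := projN _ _ g id.
  by move=> y; have [c ->] := eP y; exists [ffun i => c i]; rewrite gE;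
    apply: eq_bigr => i _; rewrite ffunE.
have sL i : linear (fun y => h y i : R^o).
  by move=> a y z; rewrite linearP !ffunE.
exists d, e, (fun i => sval (@linear_pack R N R^o _ (sL i))) => y.
rewrite -[LHS]idE -hE gE; apply: eq_bigr => i _; congr (_ *: _).
by case: (linear_pack _) => /= F ->.
Qed.

(** For a dual basis (e_i, s_i), an element z of M (x) N is determined by its
    images in M under x (x) y |-> x . s_i y, and these are natural in M. *)
Lemma dual_basis_flat : has_dual_basis -> flat N.
Proof.
move=> [d [e [s sE]]] M M' f fI.
pose sg (L : lmodType R^c) i : tensor L N -> L :=
  tensor_lift (fun x y => (s i y : R^c) *: x).
have sB (L : lmodType R^c) i : balanced (fun (x : L) y => (s i y : R^c) *: x).
  split=> [x x' y|x y y'|x a y]; first exact: scalerDr.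
    by rewrite linearD scalerDl.
  by rewrite scalerA linearZ.
have sgE L i x y : sg L i (pure_tensor x y) = (s i y : R^c) *: x.
  exact: (tensor_liftE (sB L i)).
have sgB L i : zmod_morphism (sg L i) by exact: (tensor_lift_additive (sB L i)).
have fB := @tensor_map_additive R M M' N N f idfun.
have ptB (L : lmodType R^c) (y : N) : zmod_morphism (fun x : L => pure_tensor x y).
  by move=> x x'; apply/eqP; rewrite eq_sym subr_eq -pure_tensorDl subrK.
have sum_pt (L : lmodType R^c) (x : L) (y : 'I_d -> N) :
    pure_tensor x (\sum_i y i) = \sum_i pure_tensor x (y i).
  apply: (big_morph (pure_tensor x) (pure_tensorDr x)).
  by apply: (addrI (pure_tensor x 0)); rewrite -pure_tensorDr !addr0.
have sgK L : forall z : tensor L N, z = \sum_i pure_tensor (sg L i z) (e i).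
  apply: (tensor_ext (f := id)) => // [x y|x y].
    by rewrite -sumrB; apply: eq_bigr => i _; rewrite sgB (ptB L).
  rewrite {1}(sE y) sum_pt; apply: eq_bigr => i _.
  by rewrite sgE pure_tensor_bal.
have sgf i : forall z, sg M' i (tensor_map f idfun z) = f (sg M i z).
  apply: tensor_ext => [x y|x y|x y].
  - by rewrite fB sgB.
  - by rewrite sgB linearB.
  - by rewrite tensor_mapE !sgE linearZ.
move=> z z' zz'; rewrite (sgK _ z) (sgK _ z'); apply: eq_bigr => i _.
by congr pure_tensor; apply: fI; rewrite -!sgf zz'.
Qed.

End DualBasis.

(** * Maps to and from the induced representation *)
Section Reciprocity.
Variables (K : fieldType) (gT : finGroupType) (U : {group gT}).
Local Notation C := (ind K U).
Local Notation one_U := (charfun K U).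

Lemma homG_pack (V W : rep K gT) (f : V -> W) :
    linear f -> (forall g v, f (rep_act V g v) = rep_act W g (f v)) ->
  {F : homG V W | F =1 f}.
Proof.
move=> /hom_pack[F FE] fG.
have FG : intertwines F by move=> g v; rewrite !FE fG.
by exists (HomG FG).
Qed.

Lemma homG_scaleE (V W : rep K gT) a (f : homG V W) v :
  (a *: f : homG V W) v = a *: f v.
Proof. by rewrite /hom_lfun /= scale_lfunE. Qed.

Lemma homG_0E (V W : rep K gT) v : (0 : homG V W) v = 0.
Proof. by rewrite /hom_lfun /= zero_lfunE. Qed.

Lemma act_actM (V : rep K gT) g h (v : V) :
  rep_act V g (rep_act V h v) = rep_act V (g * h)%g v.
Proof. by rewrite rep_actM comp_lfunE. Qed.

Lemma act_id (V : rep K gT) (v : V) : rep_act V 1%g v = v.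
Proof. by rewrite rep_act1 id_lfunE. Qed.

Lemma ind_actE g (c : ind_sort K U) x :
  vsval (rep_act C g c : ind_sort K U) x = vsval c (x * g)%g.
Proof. by rewrite lfunE ffunE. Qed.

Lemma ind_lmul (c : ind_sort K U) u x :
  u \in U -> vsval c (u * x)%g = vsval c x.
Proof. by move=> Uu; have /ind_spaceP->:= subvsP c. Qed.

Lemma ind_ext (c d : ind_sort K U) : vsval c =1 vsval d -> c = d.
Proof. by move=> cd; apply/val_inj/ffunP. Qed.

Lemma comp_linearl (V W X : rep K gT) (g : homG V W) :
  linear (fun f : homG W X => comp_homG f g).
Proof.
move=> a f f'; apply: homG_eq => v.
by rewrite !(comp_homGE, homG_addE, homG_scaleE).
Qed.

Lemma comp_linearr (V W X : rep K gT) (f : homG W X) :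
  linear (fun g : homG V W => comp_homG f g).
Proof.
move=> a g g'; apply: homG_eq => v.
by rewrite !(comp_homGE, homG_addE, homG_scaleE) linearP.
Qed.

Lemma charfun_in_invariants : one_U \in invariants U C.
Proof. by apply/invariantsP => u Uu; apply: charfun_invariant. Qed.

Lemma hom_invariants (V W : rep K gT) (f : homG V W) v :
  v \in invariants U V -> f v \in invariants U W.
Proof.
move=> /invariantsP vU; apply/invariantsP => u Uu.
by rewrite -hom_intertwines vU.
Qed.

Lemma hom_ind_ext (V : rep K gT) (f g : homG C V) : f one_U = g one_U -> f = g.
Proof.
move=> fg; apply: homG_eq => c; rewrite (ind_decomp c) !linear_sum.
apply: eq_bigr => y _; rewrite !linearZ /=; congr (_ *: _).
by rewrite [LHS](hom_intertwines f) [RHS](hom_intertwines g) fg.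
Qed.

(** Frobenius reciprocity: the map sends a function c to the sum over U \ G of
    c (y) y^-1 v. A sum over all of G would not do, as it is multiplied by the
    order of U, which may vanish in K. *)
Lemma frobenius_reciprocity (V : rep K gT) v :
  v \in invariants U V -> exists f : homG C V, f one_U = v.
Proof.
move=> /invariantsP vU.
pose rp (y : gT) : gT := fingroup.repr (U :* y)%g.
have rpE y : exists2 u, u \in U & rp y = (u * y)%g.
  by rewrite /rp; case: repr_rcosetP => u Uu; exists u.
have rpM u y : u \in U -> rp (u * y)%g = rp y.
  by move=> Uu; rewrite /rp rcosetM [(U :* u)%g]rcoset_id.
have rpK y : rp (rp y) = rp y by have [u Uu {1}->] := rpE y; rewrite rpM.
pose F (c : C) : V := \sum_(y | y == rp y) vsval c y *: rep_act V y^-1%g v.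
have term (c : C) u y : u \in U ->
    vsval c (u * y)%g *: rep_act V (u * y)^-1%g v =
    vsval c y *: rep_act V y^-1%g v.
  by move=> Uu; rewrite ind_lmul // invMg rep_actM comp_lfunE vU ?groupV.
have [||f fE] := @homG_pack C V F.
- move=> a c d; rewrite scaler_sumr -big_split; apply: eq_bigr => y _ /=.
  by rewrite !ffunE scalerDl -scalerA.
- move=> g c; rewrite linear_sum /F.
  (* Right translation by g permutes the cosets, here their representatives. *)
  rewrite (reindex_onto (fun z => rp (z * g^-1)%g) (fun y => rp (y * g)%g)).
    apply: congr_big => // [z|z _].
      have -> : rp (rp (z * g^-1) * g)%g = rp z.
        by have [u Uu ->] := rpE (z * g^-1)%g; rewrite -mulgA mulgKV rpM.
      by rewrite rpK eqxx eq_sym.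
    have [u Uu ->] := rpE (z * g^-1)%g.
    rewrite term // ind_actE mulgKV linearZ /= act_actM; congr (_ *: _).
    by rewrite invMg invgK.
  move=> y /eqP yE; have [u Uu ->] := rpE (y * g)%g.
  by rewrite -!mulgA mulgV mulg1 rpM.
exists f; rewrite fE /F (bigD1 (rp 1%g)) /=; last first.
  by rewrite rpK.
have [u Uu e] := rpE 1%g; rewrite {1 2}e (term one_U) // big1 ?addr0.
  by rewrite ffunE group1 scale1r invg1 act_id.
move=> y /andP[/eqP yE y1]; rewrite ffunE; case: (boolP (y \in U)) => [Uy|_];
  last by rewrite scale0r.
by case/eqP: y1; rewrite yE -{1}[y]mulg1 rpM.
Qed.

(** The other Frobenius reciprocity: G-maps to C are U-invariant functionals,
    by evaluation at the unit of G. *)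
Lemma frobenius_coreciprocity (V : rep K gT) (l : V -> K^o) :
    scalar l -> {in U, forall u v, l (rep_act V u v) = l v} ->
  exists f : homG V C,
    forall v x, vsval (f v : ind_sort K U) x = l (rep_act V x v).
Proof.
move=> lL lU; have [L LE] := @hom_pack K V K^o l lL.
have fP v : [ffun x => l (rep_act V x v)] \in ind_space K U.
  by apply/ind_spaceP => u x Uu; rewrite !ffunE rep_actM comp_lfunE lU.
have [||f fE] := @homG_pack V C (fun v => Subvs (fP v)).
- by move=> a u v; apply: ind_ext => x; rewrite !ffunE linearP lL.
- move=> g v; apply: ind_ext => x.
  by rewrite [RHS]ind_actE !ffunE act_actM.
by exists f => v x; rewrite fE ffunE.
Qed.

Definition separated (V : rep K gT) :=
  forall v : V, (forall f : homG V C, f v = 0) -> v = 0.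

Lemma generatedS (V : rep K gT) (X : {vspace V}) : (X <= generated_sub X)%VS.
Proof.
apply: subv_trans (sumv_sup 1%g _ (subvv _)) => //.
by apply/subvP => v vX; rewrite -[v]act_id memv_img.
Qed.

Lemma generated_act (V : rep K gT) (X : {vspace V}) g v :
  v \in generated_sub X -> rep_act V g v \in generated_sub X.
Proof.
move=> /memv_sumP[w wX ->]; rewrite linear_sum memv_suml // => h _.
have /memv_imgP[x xX ->] := wX h isT; rewrite /= act_actM.
by apply: (subvP (sumv_sup (g * h)%g _ (subvv _))) => //; apply: memv_img.
Qed.

Lemma generated_min (V : rep K gT) (X Y : {vspace V}) :
    (X <= Y)%VS -> (forall g v, v \in Y -> rep_act V g v \in Y) ->
  (generated_sub X <= Y)%VS.
Proof.
move=> /subvP XY YG; apply/subv_sumP => g _.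
by apply/subvP => _ /memv_imgP[v /XY vY ->]; apply: YG.
Qed.

Lemma dual_actE (V : rep K gT) g (l : 'Hom(V, K^o)) v :
  rep_act (dual V) g l v = l (rep_act V g^-1%g v).
Proof. by rewrite lfunE /= comp_lfunE. Qed.

(** The U-invariant functionals on V are the compositions of the G-maps from V
    to C with evaluation at 1, so the subrepresentation of the contragredient
    that they generate consists of functionals that jointly vanish exactly on
    the common kernel of these G-maps. *)
Lemma separated_dual (V : rep K gT) : U_generated U (dual V) <-> separated V.
Proof.
split=> [gen v v0|sepV].
  apply: functionals_separate => l.
  have : (l : dual V) \in generated_sub (invariants U (dual V)).
    by rewrite gen memvf.
  case/memv_sumP=> w wI ->; rewrite sum_lfunE big1 // => g _.
  have /memv_imgP[m /invariantsP mU ->] := wI g isT; rewrite dual_actE.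
  have [||f fE] := @frobenius_coreciprocity V (m : 'Hom(V, K^o)).
  - exact: (linearP (m : 'Hom(V, K^o))).
  - move=> u Uu x; have /lfunP/(_ x) := mU _ (groupVr Uu).
    by rewrite dual_actE invgK.
  by rewrite -fE v0 ffunE.
apply/vspaceP => l; rewrite memvf.
set D := generated_sub _.
pose beta (d : subvs_of D) (v : V) : K := (vsval d : 'Hom(V, K^o)) v.
have [||||d dE] := @pairing_surj K (subvs_of D) V beta (l : 'Hom(V, K^o)).
- by move=> v a d e; rewrite /beta /= add_lfunE scale_lfunE.
- by move=> d; exact: (linearP (vsval d : 'Hom(V, K^o))).
- move=> v vD; apply: sepV => f; apply: ind_ext => g; rewrite [RHS]ffunE.
  have [|m mE] := @hom_pack K V K^o (fun w => vsval (f w : ind_sort K U) 1%g).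
    by move=> a u w; rewrite linearP !ffunE.
  have mI : m \in invariants U (dual V).
    apply/invariantsP => u Uu; apply/lfunP => w; rewrite dual_actE !mE.
    by rewrite hom_intertwines ind_actE mul1g -[u^-1%g]mulg1 ind_lmul ?groupV.
  have gmD : rep_act (dual V) g^-1%g m \in D.
    by apply/generated_act/(subvP (generatedS _)).
  have := vD (Subvs gmD); rewrite /beta /= dual_actE invgK mE.
  by rewrite hom_intertwines ind_actE mul1g.
- exact: (linearP (l : 'Hom(V, K^o))).
have -> : l = vsval d by apply/lfunP => v; exact: dE.
exact: subvsP.
Qed.

Definition all_separated : Prop :=
  forall V : rep K gT, U_generated U V -> separated V.

Lemma E_eq_B_separated : E_eq_B K U <-> all_separated.
Proof.
split=> [EB V /EB[P [PU PD PV]]|sep V].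
  exact/separated_dual/PU/PD.
split=> [genV|[P [PU _ /PU]] //].
by exists (U_generated U); split=> // W /sep/separated_dual.
Qed.

End Reciprocity.

(** * Scalars in the Hecke algebra and the adjunction between T and F *)
Section Modules.
Variables (K : fieldType) (gT : finGroupType) (U : {group gT}).
Local Notation C := (ind K U).
Local Notation one_U := (charfun K U).
Local Notation H := (hecke K U).

Lemma ind_generated : U_generated U C.
Proof.
apply/vspaceP => c; rewrite memvf (ind_decomp c) memv_suml // => y _.
apply/memvZ/(@generated_act _ _ C)/(subvP (generatedS _))/charfun_in_invariants.
Qed.

Definition ind_obj : objE K U := ObjE ind_generated.

(** The scalars of K inside H. They are obtained from an opaque proof so that
    conversion never unfolds them. *)
Fact hscalar_pack a : {h : H | forall c, h c = a *: c}.
Proof.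
by exists (a *: id_homG C) => c; rewrite homG_scaleE [id_homG C c]id_lfunE.
Qed.

Definition hscalar a : H := sval (hscalar_pack a).

Lemma hscalarE a c : hscalar a c = a *: c.
Proof. exact: (svalP (hscalar_pack a)). Qed.

Lemma hscalarM a b : hscalar a * hscalar b = hscalar (a * b).
Proof.
by apply: homG_eq => c; rewrite [LHS]comp_homGE !hscalarE scalerA.
Qed.

Lemma hscalar1 : hscalar 1 = 1.
Proof. by apply: homG_eq => c; rewrite hscalarE scale1r [RHS]id_lfunE. Qed.

Lemma hscalarD a b : hscalar (a + b) = hscalar a + hscalar b.
Proof.
by apply: homG_eq => c; rewrite [RHS]homG_addE !hscalarE scalerDl.
Qed.

Lemma hscalar_mulr a (h : H) : h * hscalar a = a *: (h : homG C C).
Proof.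
by apply: homG_eq => c; rewrite [LHS]comp_homGE hscalarE homG_scaleE linearZ.
Qed.

Lemma F_scalar (V : rep K gT) a (x : homG C V) :
  (hscalar a : H^c) *: (x : F_sort U V) = a *: x.
Proof.
by apply: homG_eq => c; rewrite [LHS]comp_homGE hscalarE linearZ homG_scaleE.
Qed.

Lemma ind_mod_fg : finitely_generated (ind_mod K U).
Proof.
set b := vbasis {: ind_sort K U}.
exists (\dim {: ind_sort K U}), (fun i => b`_i : ind_mod K U) => c.
exists (fun i => hscalar (coord b i (c : ind_sort K U))).
rewrite {1}(coord_vbasis (memvf (c : ind_sort K U))).
by apply: eq_bigr => i _; rewrite [RHS]hscalarE.
Qed.

Section Tensor.
Variable m : fgmod K U.

Lemma unit_T_pack (x : m) :
  {f : homG C (T_rep m) | forall c, f c = pure_tensor x (c : ind_mod K U)}.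
Proof.
have [||f fE] := @homG_pack K gT C (T_rep m)
    (fun c => pure_tensor x (c : ind_mod K U)).
- by move=> a c d; rewrite pure_tensorDr; congr (_ + _); rewrite [RHS]T_scaleE.
- by move=> g c; rewrite T_repE.
by exists f.
Qed.

Definition unit_T x : F_sort U (T_rep m) := sval (unit_T_pack x).

Lemma unit_TE x c : unit_T x c = pure_tensor x (c : ind_mod K U).
Proof. exact: (svalP (unit_T_pack x)). Qed.

Lemma unit_T_linear : linear unit_T.
Proof.
move=> h x y; apply: homG_eq => c; rewrite homG_addE !unit_TE pure_tensorDl.
by rewrite pure_tensor_bal [in RHS]comp_homGE unit_TE.
Qed.

Lemma T_ext (V : rep K gT) (f g : homG (T_rep m) V) :
    (forall (x : m) (c : ind_mod K U),
       f (pure_tensor x c : T_sort m) = g (pure_tensor x c : T_sort m)) ->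
  f =1 g.
Proof.
by move=> fg; apply: (@tensor_ext _ _ _ _ f g) fg => u v; exact: linearB.
Qed.

(** The K-linear form of the universal property of m (x)_H C, for targets that
    need not carry an action of G. *)
Lemma T_lift_pack (W : vectType K) (ph : m -> ind_mod K U -> W) :
    balanced ph -> (forall x a c, ph x (ind_scale a c) = a *: ph x c) ->
  {f : 'Hom(T_rep m, W) |
     forall (x : m) (c : ind_mod K U), f (pure_tensor x c : T_sort m) = ph x c}.
Proof.
move=> phB phZ; pose f : T_sort m -> W := tensor_lift ph.
have fB : zmod_morphism f by exact: tensor_lift_additive.
have fE x c : f (pure_tensor x c) = ph x c by exact: tensor_liftE.
have fD u v : f (u + v) = f u + f v.
  pose F : {additive T_sort m -> W} :=
    HB.pack f (GRing.isZmodMorphism.Build _ _ f fB).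
  exact: (raddfD F).
have [|F FE] := @hom_pack K (T_rep m) W f; last by exists F => x c; rewrite FE.
move=> a u v; rewrite fD; congr (_ + _); move: u.
apply: (@tensor_ext _ _ _ _
  (fun z => f (a *: (z : T_sort m))) (fun z => a *: f z)).
- by move=> x y; rewrite scalerBr fB.
- by move=> x y; rewrite fB scalerBr.
- by move=> x c; rewrite [a *: _]T_scaleE !fE phZ.
Qed.

Lemma adjunct_pack (V : rep K gT) (phi : {linear m -> F_sort U V}) :
  {f : homG (T_rep m) V |
     forall (x : m) (c : ind_mod K U),
       f (pure_tensor x c : T_sort m) = (phi x : homG C V) c}.
Proof.
have [||f fE] := @T_lift_pack V (fun x c => (phi x : homG C V) c).
- split=> [x y c|x c d|x h c]; last 1 first.
  + by rewrite linearZ [LHS]comp_homGE.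
  + by rewrite linearD [LHS]homG_addE.
  + exact: linearD.
- by move=> x a c; exact: linearZ.
suff fG : intertwines (f : 'Hom(T_rep m, V)) by exists (HomG fG).
move=> g; apply: (@tensor_ext _ _ _ _ (fun z => f (rep_act (T_rep m) g z))
                     (fun z => rep_act V g (f z))).
- by move=> x y; rewrite !linearB.
- by move=> x y; rewrite !linearB.
- by move=> x c; rewrite T_repE !fE [LHS]hom_intertwines.
Qed.

Definition adjunct V phi : homG (T_rep m) V := sval (adjunct_pack phi).

Lemma adjunctE V (phi : {linear m -> F_sort U V}) x (c : ind_mod K U) :
  adjunct phi (pure_tensor x c : T_sort m) = (phi x : homG C V) c.
Proof. exact: (svalP (adjunct_pack phi)). Qed.

End Tensor.
End Modules.

(** * Right Hecke modules as vector spaces *)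
Section Restriction.
Variables (K : fieldType) (gT : finGroupType) (U : {group gT}) (m : fgmod K U).
Local Notation C := (ind K U).
Local Notation H := (hecke K U).

(** The K-space underlying a right H-module, needed to speak of its linear
    functionals. *)
Definition restriction : Type := fg_sort m.
HB.instance Definition _ := GRing.Zmodule.on restriction.

Definition restrict_scale (a : K) (x : restriction) : restriction :=
  (hscalar U a : H^c) *: (x : m).

Fact restrict_scaleA a b x :
  restrict_scale a (restrict_scale b x) = restrict_scale (a * b) x.
Proof.
rewrite /restrict_scale (@scalerA H^c m).
apply: (congr1 (fun h : H^c => h *: (x : m))).
by rewrite mulrC -hscalarM.
Qed.

Fact restrict_scale1 : left_id 1 restrict_scale.
Proof.
move=> x; rewrite /restrict_scale -[RHS](@scale1r H^c m).
apply: (congr1 (fun h : H^c => h *: (x : m))).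
exact: hscalar1.
Qed.

Fact restrict_scaleDr : right_distributive restrict_scale +%R.
Proof. by move=> a x y; exact: (@scalerDr H^c m). Qed.

Fact restrict_scaleDl x : {morph restrict_scale^~ x : a b / a + b}.
Proof.
move=> a b; rewrite /restrict_scale -[RHS](@scalerDl H^c m).
apply: (congr1 (fun h : H^c => h *: (x : m))).
exact: hscalarD.
Qed.

HB.instance Definition _ := GRing.Zmodule_isLmodule.Build K restriction
  restrict_scaleA restrict_scale1 restrict_scaleDr restrict_scaleDl.

Fact restriction_fg : finitely_generated (restriction : lmodType K).
Proof.
have [d [e eP]] := fg_finite m.
pose r : nat := \dim {: homG C C}.
pose b : r.-tuple (homG C C) := vbasis {: homG C C}.
apply: (@finitely_generated_fin K restriction ('I_d * 'I_r)%type
  (fun k => ((b`_k.2 : H) : H^c) *: (e k.1 : m))) => x.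
have [c ->] := eP x.
exists (fun k => coord b k.2 (c k.1 : homG C C)).
rewrite -(pair_bigA _ (fun i j => coord b j (c i : homG C C) *:
   ((((b`_j : H) : H^c) *: (e i : m)) : restriction))) /=.
apply: eq_bigr => i _.
rewrite {1}(coord_vbasis (memvf (c i : homG C C))).
rewrite (@scaler_suml H^c m); apply: eq_bigr => j _.
rewrite [RHS](@scalerA H^c m).
apply: (congr1 (fun h : H^c => h *: (e i : m))).
by rewrite [RHS]hscalar_mulr.
Qed.

HB.instance Definition _ :=
  Lmodule_hasFinDim.Build K restriction (projT2 (fg_vect_axiom restriction_fg)).

End Restriction.

Section Dual.
Variables (K : fieldType) (gT : finGroupType) (U : {group gT}).
Local Notation C := (ind K U).
Local Notation H := (hecke K U).

(** The right H-module whose evaluation pairing with C produces a dual basis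
    of C. *)
Definition dual_ind : Type := 'Hom(C, K^o).
HB.instance Definition _ := GRing.Zmodule.on dual_ind.

Definition dual_ind_scale (h : H^c) (l : dual_ind) : dual_ind :=
  ((l : 'Hom(C, K^o)) \o (h : H))%VF.

Fact dual_ind_scaleA a b l :
  dual_ind_scale a (dual_ind_scale b l) = dual_ind_scale (a * b) l.
Proof.
by apply/lfunP => c; rewrite !comp_lfunE; congr ((l : 'Hom(C, K^o)) _).
Qed.

Fact dual_ind_scale1 : left_id 1 dual_ind_scale.
Proof. by move=> l; apply/lfunP => c; rewrite comp_lfunE [(1 : H) c]id_lfunE. Qed.

Fact dual_ind_scaleDr : right_distributive dual_ind_scale +%R.
Proof. by move=> a l l'; apply/lfunP => c; rewrite !(comp_lfunE, add_lfunE). Qed.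

Fact dual_ind_scaleDl l : {morph dual_ind_scale^~ l : a b / a + b}.
Proof.
move=> a b; apply/lfunP => c.
by rewrite add_lfunE !comp_lfunE [X in _ X = _]homG_addE linearD.
Qed.

HB.instance Definition _ := GRing.Zmodule_isLmodule.Build H^c dual_ind
  dual_ind_scaleA dual_ind_scale1 dual_ind_scaleDr dual_ind_scaleDl.

Lemma dual_ind_scalar a (l : dual_ind) :
  (hscalar U a : H^c) *: l = (a *: (l : 'Hom(C, K^o)) : 'Hom(C, K^o)).
Proof.
apply/lfunP => c; rewrite scale_lfunE comp_lfunE.
by rewrite [X in fun_of_lfun _ X = _]hscalarE linearZ.
Qed.

Fact dual_ind_fg : finitely_generated (dual_ind : lmodType H^c).
Proof.
pose b := vbasis {: 'Hom(C, K^o)}.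
exists (\dim {: 'Hom(C, K^o)}), (fun i => b`_i : dual_ind) => l.
exists (fun i => hscalar U (coord b i (l : 'Hom(C, K^o))) : H^c).
rewrite {1}(coord_vbasis (memvf (l : 'Hom(C, K^o)))).
by apply: eq_bigr => i _; rewrite dual_ind_scalar.
Qed.

Definition dual_ind_mod : fgmod K U := FgMod dual_ind_fg.

End Dual.

(** * Consequences of a Frobenius form on the Hecke algebra *)
Section Frobenius.
Variables (K : fieldType) (gT : finGroupType) (U : {group gT}).
Local Notation C := (ind K U).
Local Notation one_U := (charfun K U).
Local Notation H := (hecke K U).

Definition frobenius_form (tau : H -> K) : Prop :=
  scalar (tau : homG C C -> K) /\
  forall h, (forall h', tau (h' * h) = 0) -> h = 0.

Variables (tau : H -> K) (tauP : frobenius_form tau).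

Let tauL : scalar (tau : homG C C -> K) := tauP.1.

Lemma hecke_scaleAl a (h h' : homG C C) :
  (a *: h : H) * (h' : H) = a *: ((h : H) * (h' : H) : homG C C).
Proof.
by apply: homG_eq => c; rewrite [LHS]comp_homGE !homG_scaleE [in RHS]comp_homGE.
Qed.

Lemma hecke_scaleAr a (h h' : homG C C) :
  (h : H) * (a *: h' : H) = a *: ((h : H) * (h' : H) : homG C C).
Proof.
apply: homG_eq => c.
by rewrite [LHS]comp_homGE !homG_scaleE [in RHS]comp_homGE linearZ.
Qed.

Lemma tau_mull_scalar (h : H) : scalar (fun h' : homG C C => tau (h * (h' : H))).
Proof. by move=> a x y; rewrite -tauL mulrDr hecke_scaleAr. Qed.

Lemma tau_mulr_scalar (h : H) : scalar (fun h' : homG C C => tau ((h' : H) * h)).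
Proof. by move=> a x y; rewrite -tauL mulrDl hecke_scaleAl. Qed.

Lemma tau_nondeg h : (forall h', tau (h * h') = 0) -> h = 0.
Proof.
exact: (@pairing_nondegC K (homG C C) (fun h h' => tau ((h : H) * (h' : H)))
  tau_mulr_scalar tau_mull_scalar tauP.2).
Qed.

Lemma tauD h h' : tau (h + h') = tau h + tau h'.
Proof. by rewrite -[h in LHS]scale1r (tauL 1) mul1r. Qed.

Lemma tauB h h' : tau (h - h') = tau h - tau h'.
Proof. by rewrite addrC -scaleN1r (tauL (-1)) mulN1r addrC. Qed.

Lemma tau0 : tau 0 = 0.
Proof. by rewrite -(subrr 0) tauB subrr. Qed.

Lemma tau_mulr_inj (x y : H) : (forall h, tau (x * h) = tau (y * h)) -> x = y.
Proof.
move=> xy; apply/eqP; rewrite -subr_eq0; apply/eqP/tau_nondeg => h.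
by rewrite mulrBl tauB xy subrr.
Qed.

Lemma tau_mull_inj (x y : H) : (forall h, tau (h * x) = tau (h * y)) -> x = y.
Proof.
move=> xy; apply/eqP; rewrite -subr_eq0; apply/eqP/tauP.2 => h.
by rewrite mulrBr tauB xy subrr.
Qed.

Lemma tau_rep (lam : homG C C -> K^o) : scalar lam ->
  exists t : H, forall h, lam h = tau (t * h).
Proof.
move=> lamL.
exact: (@pairing_surj K (homG C C) (homG C C) _ lam
  tau_mulr_scalar tau_mull_scalar tauP.2).
Qed.

(** The functional h |-> lam (x h) on H is of the form h |-> tau (phi x * h) for
    a unique phi x, and uniqueness makes phi linear over H. The hypothesis is
    K-linearity of lam. *)
Lemma coinduction (m : fgmod K U) (lam : m -> K) :
    (forall a x y, lam ((hscalar U a : H^c) *: x + y) = a * lam x + lam y) ->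
  exists phi : {linear m -> F_sort U C}, forall x, lam x = tau (phi x).
Proof.
move=> lamL.
have lamD x y : lam (x + y) = lam x + lam y.
  by have := lamL 1 x y; rewrite hscalar1 (@scale1r H^c m) mul1r.
have rep x : exists t : H, forall h : H, lam ((h : H^c) *: x) = tau (t * h).
  apply: (@tau_rep (fun h : homG C C => lam ((h : H^c) *: x))) => a h h'.
  rewrite -[RHS]lamL (@scalerA H^c m) -(@scalerDl H^c m).
  apply: (congr1 (fun g : H^c => lam (g *: x))).
  by rewrite -hscalar_mulr.
have [|phi phiE] := @linear_pack _ m (F_sort U C) (fun x => sval (cid (rep x))).
  move=> h x y; apply: tau_mulr_inj => h'.
  rewrite [in RHS]mulrDl tauD.
  rewrite -(svalP (cid (rep _))) -(svalP (cid (rep y))).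
  rewrite -[in RHS]mulrA -(svalP (cid (rep x))).
  by rewrite (@scalerDr H^c m) (@scalerA H^c m) lamD.
exists phi => x; rewrite phiE -[sval _]mulr1 -(svalP (cid (rep x))).
by rewrite (@scale1r H^c).
Qed.

(** The pairing (theta, x) |-> tau (theta o x) between Hom_G(V, C) and F(V) is
    nondegenerate on F(V): replacing theta by h o theta shows that a null x has
    theta o x = 0 for all theta, and V is separated. So tau o chi is
    represented by some theta, and H-linearity removes tau. *)
Lemma separated_hom_lift (V : rep K gT)
    (chi : {linear F_sort U V -> F_sort U C}) :
  separated U V -> exists theta : homG V C, forall x, chi x = comp_homG theta x.
Proof.
move=> sepV.
have [||||theta thE] := @pairing_surj K (homG V C) (homG C V)
  (fun th x => tau (comp_homG th x)) (fun x => tau (chi x)).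
- by move=> x a th th'; rewrite -tauL comp_linearl.
- by move=> th a x x'; rewrite -tauL comp_linearr.
- move=> x x0; apply: homG_eq => c; rewrite homG_0E; apply: sepV => f.
  suff fx0 : comp_homG f x = 0 by rewrite -comp_homGE fx0 homG_0E.
  apply: tauP.2 => h; rewrite -[RHS](x0 (comp_homG h f)); congr tau.
  by apply: homG_eq => d; rewrite [LHS]comp_homGE !comp_homGE.
- move=> a x y; rewrite -[RHS]tauL; congr tau.
  rewrite -(F_scalar a x) -(F_scalar a (chi x)).
  exact: (linearP chi).
exists theta => x; apply: tau_mulr_inj => h.
have := thE ((h : H^c) *: (x : F_sort U V)); rewrite linearZ => e.
rewrite [LHS]e; congr tau.
by apply: homG_eq => d; rewrite [RHS]comp_homGE !comp_homGE.
Qed.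

Lemma hecke_maps_separate (m : fgmod K U) (x : m) :
  (forall phi : {linear m -> F_sort U C}, phi x = 0) -> x = 0.
Proof.
move=> x0; apply: (@functionals_separate K (restriction m) x) => l.
have [|phi phiE] := @coinduction m l; first by move=> a y z; exact: (linearP l).
by rewrite phiE x0 tau0.
Qed.

(** A linear map phi from m to F(C) factors through the unit, as it is
    recovered from its adjunct from T(m) to C; and such maps separate the points
    of m. *)
Lemma unit_T_inj (m : fgmod K U) (x : m) : unit_T x = 0 -> x = 0.
Proof.
move=> x0; apply: hecke_maps_separate => phi; apply: homG_eq => c.
have := congr1 (fun f : homG C (T_rep m) => f c) x0.
rewrite unit_TE homG_0E => xc0.
have := adjunctE phi x (c : ind_mod K U).
by rewrite xc0 linear0 homG_0E => <-.
Qed.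

(** An H-linear map from F(T(m)) to F(C) that vanishes on the image of the unit
    comes from a G-map psi from T(m) to C, by separatedness, and psi vanishes on
    all pure tensors. Hence no functional distinguishes F(T(m)) from that
    image. *)
Lemma unit_T_surj (m : fgmod K U) (f : F_sort U (T_rep m)) :
  separated U (T_rep m) -> exists x, f = unit_T x.
Proof.
move=> sepT.
have [|E EE] := @hom_pack K (restriction m) (homG C (T_rep m)) (@unit_T _ _ _ m).
  move=> a x y; rewrite -(F_scalar a (unit_T x)).
  exact: (@unit_T_linear _ _ _ m (hscalar U a)).
suff /memv_imgP[x _ ->] : (f : homG C (T_rep m)) \in limg E.
  by exists x; rewrite EE.
apply: functionals_detect_subspace => l lE.
have [|phi phiE] := @coinduction (F_obj (T_obj m))
    (fun x => l (x : homG C (T_rep m))).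
  by move=> a x y; rewrite (F_scalar a x) linearP.
have phi0 x : phi (unit_T x) = 0.
  apply: tau_nondeg => h.
  have e : phi ((h : H^c) *: (unit_T x : F_obj (T_obj m))) =
      (h : H^c) *: phi (unit_T x) by rewrite linearZ.
  rewrite -[LHS]/(tau ((h : H^c) *: phi (unit_T x))) -e -phiE.
  have [|M ME] := @linear_pack _ m (F_sort U (T_rep m)) (@unit_T _ _ _ m).
    exact: unit_T_linear.
  have : M ((h : H^c) *: x) = (h : H^c) *: M x by rewrite linearZ.
  by rewrite !ME => <-; apply: lE; rewrite -EE memv_img ?memvf.
have [psi psiE] := separated_hom_lift phi sepT.
have psi0 : psi =1 (0 : homG _ _).
  by apply: T_ext => x c; rewrite -unit_TE -comp_homGE -psiE phi0 !homG_0E.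
suff f0 : phi f = 0 by rewrite phiE f0 tau0.
rewrite psiE; apply: homG_eq => c.
by rewrite comp_homGE psi0 !homG_0E.
Qed.

Lemma T_invariant (m : fgmod K U) v :
    separated U (T_rep m) -> v \in invariants U (T_rep m) ->
  exists x : m, v = pure_tensor x (charfun K U : ind_mod K U).
Proof.
move=> sepT /frobenius_reciprocity[f <-]; have [x ->] := unit_T_surj f sepT.
by exists x; rewrite unit_TE.
Qed.

Lemma T_invariant_inj (m : fgmod K U) (x : m) :
  pure_tensor x (charfun K U : ind_mod K U) = 0 -> x = 0.
Proof.
move=> x0; apply: unit_T_inj; apply: hom_ind_ext.
by rewrite unit_TE x0 homG_0E.
Qed.

End Frobenius.

(** * The equivalences, given a Frobenius form and enough invariants *)
Section Equivalences.
Variables (K : fieldType) (gT : finGroupType) (U : {group gT}).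
Local Notation C := (ind K U).
Local Notation one_U := (charfun K U).
Local Notation H := (hecke K U).

(** Stated for stable subspaces X of V, so that a kernel need not be made into a
    representation. *)
Definition invariants_detect : Prop :=
  forall (V : rep K gT) (X : {vspace V}),
    (forall g v, v \in X -> rep_act V g v \in X) ->
    (forall v, v \in X -> v \in invariants U V -> v = 0) -> X = 0%VS.

Hypothesis detectP : invariants_detect.
Variables (tau : H -> K) (tauP : frobenius_form tau).

Lemma hom_injective (V W : rep K gT) (f : homG V W) :
    (forall v, v \in invariants U V -> f v = 0 -> v = 0) ->
  injective f.
Proof.
move=> f0; apply/lker0P/eqP/detectP => [g v|v].
  by rewrite !memv_ker hom_intertwines => /eqP->; rewrite linear0.
by rewrite memv_ker => /eqP fv vI; apply: f0.
Qed.

Definition counit (V : objE K U) : homG (T_rep (F_obj V)) V :=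
  adjunct (idfun : {linear F_obj V -> F_sort U V}).

Lemma counitE (V : objE K U) (x : F_obj V) (c : ind_mod K U) :
  counit V (pure_tensor x c : T_sort (F_obj V)) = (x : homG C V) c.
Proof. exact: adjunctE. Qed.

Lemma counit_surj (V : objE K U) : limg (counit V) = fullv.
Proof.
apply/eqP; rewrite eqEsubv; apply/andP; split; first exact: subvf.
rewrite -[X in (X <= _)%VS](E_generated V).
apply: generated_min => [|g w /memv_imgP[z _ ->]]; last first.
  by rewrite -hom_intertwines memv_img ?memvf.
apply/subvP => w /frobenius_reciprocity[x xE].
by rewrite -xE -(@counitE V x) memv_img ?memvf.
Qed.

(** Since the counit of V is then bijective, a linear map phi from F(V) to F(W)
    yields a G-map by composing its adjunct with the inverse of the counit. *)
Lemma counit_inj_full (V W : objE K U) (phi : {linear F_obj V -> F_obj W}) :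
  injective (counit V) -> exists f : homG V W, forall x, phi x = F_map f x.
Proof.
move=> /lker0P cI.
set al := adjunct (phi : {linear F_obj V -> F_sort U W}).
pose F : 'Hom(V, W) := (al \o (counit V)^-1)%VF.
have FE z : F (counit V z) = al z by rewrite comp_lfunE lker0_lfunK.
have FG : intertwines F.
  move=> g v; have : v \in limg (counit V) by rewrite counit_surj memvf.
  by case/memv_imgP=> z _ ->; rewrite -hom_intertwines !FE hom_intertwines.
exists (HomG FG) => x; apply: homG_eq => c.
by rewrite comp_homGE -(@counitE V x c) [RHS]FE adjunctE.
Qed.

(** The common kernel X of the G-maps to C is stable under G. A U-invariant
    vector of X corresponds to x in F(V); by fullness the H-linear maps from
    F(V) to H all come from G-maps from V to C, hence kill x, but they
    separate the points of F(V). *)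
Lemma full_separates : F_full K U -> all_separated K U.
Proof.
move=> full V genV.
pose X : {vspace V} := (\bigcap_(i < \dim {: homG V C})
  lker (hom_lfun (vbasis {: homG V C})`_i))%VS.
have XP v : v \in X <-> forall psi : homG V C, psi v = 0.
  split=> [|v0]; last first.
    by rewrite memvE; apply/subv_bigcapP => i _; rewrite -memvE memv_ker v0.
  rewrite memvE => /subv_bigcapP vX psi.
  have [|ev evE] := @hom_pack K (homG V C) C (fun f : homG V C => f v).
    by move=> a f f'; rewrite homG_addE homG_scaleE.
  rewrite -evE (coord_vbasis (memvf psi)) linear_sum big1 // => i _.
  rewrite linearZ /= evE; have := vX i isT.
  by rewrite -memvE memv_ker => /eqP->; rewrite scaler0.
suff X0 : X = 0%VS by move=> v /XP; rewrite X0 memv0 => /eqP.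
apply: detectP => [g v /XP v0|v /XP v0 vI].
  by apply/XP => psi; rewrite hom_intertwines v0 linear0.
have [x xE] := frobenius_reciprocity vI.
pose VE := ObjE genV.
suff x0 : (x : F_obj VE) = 0 by rewrite -xE x0 homG_0E.
apply: (hecke_maps_separate tauP) => phi.
have [f fE] := full VE (ind_obj K U) phi.
rewrite fE; apply: hom_ind_ext.
by rewrite comp_homGE [X in f X]xE v0 homG_0E.
Qed.

(** Every U-invariant vector of T(M) is y (x) 1_U for a unique y, because the
    units are bijective; so the invariants of the kernel of T(g) come from the
    kernel of g, that is, from the image of f. *)
Lemma separated_T_exact : all_separated K U -> T_exact K U.
Proof.
move=> sep L M N f g fg.
have sepT (m : fgmod K U) : separated U (T_rep m).
  by apply: sep; exact: T_generated.
have TE (m m' : fgmod K U) (h : {linear m -> m'}) (x : m) (c : ind_mod K U) :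
    T_map h (pure_tensor x c : T_sort m) = pure_tensor (h x) c.
  by rewrite [LHS]lfunE [LHS]T_map_funE.
apply: subv_anti; apply/andP; split.
  suff /subvP sub : (fullv <= T_map f @^-1: ker_E U (T_map g))%VS.
    by apply/subvP => _ /memv_imgP[z zV ->]; rewrite memv_preim sub.
  rewrite -(T_generated L); apply: generated_min => [|h w]; last first.
    by rewrite -!memv_preim hom_intertwines; exact: generated_act.
  apply/subvP => v vI; rewrite -memv_preim; apply: (subvP (generatedS _)).
  rewrite memv_cap hom_invariants // andbT memv_ker -comp_homGE.
  suff -> : comp_homG (T_map g) (T_map f) =1 (0 : homG (T_rep L) (T_rep N)).
    by rewrite homG_0E.
  apply: T_ext => x c; rewrite comp_homGE !TE homG_0E.
  have -> : g (f x) = 0 by apply/fg; exists x.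
  exact: pure_tensor0l.
apply: generated_min => [|h w /memv_imgP[z _ ->]]; last first.
  by rewrite -hom_intertwines memv_img ?memvf.
apply/subvP => v; rewrite memv_cap memv_ker => /andP[/eqP gv vI].
have [y yE] := T_invariant tauP (sepT M) vI.
rewrite yE TE in gv; have [x xy] := (fg y).1 (T_invariant_inj tauP gv).
by rewrite yE -xy -TE memv_img ?memvf.
Qed.

(** What exactness of T says about injections; flatness in full is recovered
    from it through a dual basis. *)
Definition fg_flat : Prop := forall (m m' : fgmod K U) (f : {linear m -> m'}),
  injective f -> injective (tensor_map f (@idfun (ind_mod K U))).

(** Exactness of 0 -> m -> m' says that the kernel of T(f) in E vanishes; the
    usual kernel has then no U-invariants, so it vanishes as well. A zero
    endomorphism of m takes the place of the map from the zero module. *)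
Lemma T_exact_flat : T_exact K U -> fg_flat.
Proof.
move=> ex m m' f fI.
have [|z zE] := @linear_pack _ m m (fun=> 0).
  by move=> a x y; rewrite scaler0 addr0.
have /ex e : exact_mod z f.
  move=> y; split=> [fy|[x <-]]; last by rewrite zE linear0.
  by exists 0; rewrite zE; apply: fI; rewrite fy linear0.
suff TI : injective (T_map f) by move=> u v uv; apply: TI; rewrite !lfunE.
apply: hom_injective => v vI Tv.
have : v \in ker_E U (T_map f).
  by apply: (subvP (generatedS _)); rewrite memv_cap vI memv_ker Tv eqxx.
rewrite -e => /memv_imgP[w _ ->].
suff -> : T_map z =1 (0 : homG (T_rep m) (T_rep m)) by rewrite homG_0E.
apply: T_ext => x c; rewrite homG_0E [LHS]lfunE [LHS]T_map_funE zE.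
exact: pure_tensor0l.
Qed.

(** Coinducing the coordinates of m embeds it in a power H^b, so that T(m)
    embeds in T(H^b), which is C^b. *)
Lemma fg_flat_separated : fg_flat -> forall m : fgmod K U, separated U (T_rep m).
Proof.
move=> flatC m v v0.
pose b := \dim {: restriction m}.
pose co i : restriction m -> K := coord (vbasis {: restriction m}) i.
have coP i := @coinduction _ _ _ _ tauP m (co i)
  (fun a x y => linearP (coord (vbasis {: restriction m}) i) a x y).
pose phi i := sval (cid (coP i)).
have phiE i x : co i x = tau (phi i x) by exact: (svalP (cid (coP i))).
pose P : fgmod K U :=
  FgMod (finitely_generated_ffun b (F_finite U C)).
have [|J JE] := @linear_pack _ m P (fun x => [ffun i => phi i x]).
  by move=> h x y; apply/ffunP => i; rewrite !ffunE linearP.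
have JI : injective J.
  move=> x y /eqP; rewrite -subr_eq0 -linearB JE => /eqP/ffunP xy.
  apply/eqP; rewrite -subr_eq0; apply/eqP.
  rewrite [LHS](@coord_vbasis K (restriction m) _ _ (memvf _)) big1 // => i _.
  have := xy i; rewrite !ffunE => e.
  by rewrite [coord _ _ _]phiE e (tau0 tauP) scale0r.
(* The standard generators of H^b; the components of the image of z in C^b are
   the adjuncts of the components of J. *)
pose delta i : P :=
  [ffun k : 'I_b => if k == i then (1 : H) : F_sort U C else 0].
have TJ : forall z : T_rep m,
    T_map J z = \sum_i unit_T (delta i) (adjunct (phi i) z).
  apply: tensor_ext => [x y|x y|x c].
  - exact: linearB.
  - by rewrite -sumrB; apply: eq_bigr => i _; rewrite !linearB.
  rewrite [LHS]lfunE [LHS]T_map_funE JE.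
  transitivity (\sum_i pure_tensor ((phi i x : H^c) *: delta i) c : T_sort P).
    rewrite -pure_tensor_suml; congr pure_tensor; apply/ffunP => k.
    rewrite sum_ffunE (bigD1 k) //= big1 => [|i /negPf ik].
      rewrite !ffunE eqxx addr0; apply: homG_eq => d.
      by rewrite [RHS]comp_homGE [RHS]id_lfunE.
    by rewrite !ffunE eq_sym ik scaler0.
  apply: eq_bigr => i _; rewrite adjunctE unit_TE.
  exact: pure_tensor_bal.
apply: (flatC _ _ _ JI).
have Jv : T_map J v = 0.
  by rewrite TJ big1 // => i _; rewrite v0 linear0.
have J0 : T_map_fun J 0 = 0 by exact: linear0.
by rewrite lfunE in Jv; exact: (etrans Jv (esym J0)).
Qed.

(** The invariants of T(F(V)) are the x (x) 1_U, and the counit sends such an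
    element to x (1_U), which determines x. *)
Lemma fg_flat_full : fg_flat -> F_full K U.
Proof.
move=> flatC V W phi; apply/counit_inj_full/hom_injective => v vI v0.
have [x xE] := T_invariant tauP (fg_flat_separated flatC (m := F_obj V)) vI.
rewrite xE counitE in v0.
suff x0 : x = 0 by rewrite xE x0 pure_tensor0l.
by apply: hom_ind_ext; rewrite v0 homG_0E.
Qed.

(** Let m be the linear dual of C. As T(m) is separated, evaluation on T(m) is
    a combination of functionals a_k o theta_k, with theta_k : T(m) -> C and a_k
    in the dual of C. Read through tau, the map l |-> theta_k (l (x) -) from m
    to H is evaluation at a vector e_k, and a_k is a linear map s_k from C to H.
    The identity l c = sum_k a_k (theta_k (l (x) c)) then says that l takes the
    same value at c and at the sum of the s_k(c) e_k. *)
Lemma fg_flat_dual_basis : fg_flat -> has_dual_basis (ind_mod K U).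
Proof.
move=> flatC; pose m := dual_ind_mod K U; pose V := T_rep m.
have sepV : separated U V := fg_flat_separated flatC (m := m).
have [||ev evE] := @T_lift_pack K gT U m K^o (fun l c => (l : 'Hom(C, K^o)) c).
- split=> [l l' c|l c c'|l h c]; first by rewrite add_lfunE.
    exact: linearD.
  by rewrite [LHS]comp_lfunE.
- by move=> l a c; exact: linearZ.
pose b := \dim {: homG V C}.
pose theta (k : 'I_b) : homG V C := (vbasis {: homG V C})`_k.
(* The theta_k embed T(m) in a power of C, so every functional on T(m) extends
   to that power. *)
have [||||a aE] := @pairing_surj K {ffun 'I_b -> 'Hom(C, K^o)} V
    (fun a v => \sum_k a k (theta k v)) ev.
- move=> v a x y; rewrite mulr_sumr -big_split; apply: eq_bigr => k _.
  by rewrite !ffunE add_lfunE scale_lfunE.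
- move=> a c x y; rewrite mulr_sumr -big_split; apply: eq_bigr => k _.
  by rewrite !linearP.
- move=> v v0; apply: sepV => psi; apply: functionals_separate => l.
  rewrite -[RHS](v0 [ffun k => coord (vbasis {: homG V C}) k psi *: l]).
  have [|e eE] := @hom_pack K (homG V C) C (fun f : homG V C => f v).
    by move=> c f f'; rewrite homG_addE homG_scaleE.
  rewrite -eE {1}(coord_vbasis (memvf psi)) !linear_sum; apply: eq_bigr => k _.
  by rewrite ffunE scale_lfunE !linearZ /= eE.
- by move=> c x y; rewrite linearP.
have [phi phiE] : {phi : 'I_b -> {linear m -> F_sort U C} |
    forall k l c, (phi k l : homG C C) c =
      theta k (pure_tensor l (c : ind_mod K U) : T_sort m)}.
  have phL k : linear (fun l : m => comp_homG (theta k) (unit_T l) : F_sort U C).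
    move=> h l l'; rewrite unit_T_linear.
    exact: (@F_map_linear _ _ _ (T_obj m) (ind_obj K U) (theta k)).
  exists (fun k => sval (linear_pack (phL k))) => k l c.
  by rewrite (svalP (linear_pack (phL k))) comp_homGE unit_TE.
have tau_phi k : exists e : C, forall l : m, tau (phi k l) = (l : 'Hom(C, K^o)) e.
  apply: (@pairing_surj K C 'Hom(C, K^o) (fun e l => l e)
    (fun l : 'Hom(C, K^o) => tau (phi k (l : m)))).
  - by move=> l; exact: (linearP (l : 'Hom(C, K^o))).
  - by move=> c a' l l'; rewrite add_lfunE scale_lfunE.
  - by move=> l l0; apply/lfunP => c; rewrite l0 zero_lfunE.
  - move=> a' l l'; rewrite -(tauP.1) -(dual_ind_scalar a' l) -(F_scalar a').
    by rewrite linearP.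
pose e k := sval (cid (tau_phi k)).
have s_ex k (c : C) : exists s : H, forall h : H, a k (h c) = tau (h * s).
  have [||||s sE] := @pairing_surj K (homG C C) (homG C C)
    (fun s h => tau ((h : H) * (s : H))) (fun h : homG C C => a k (h c)).
  - by move=> h; exact: tau_mull_scalar.
  - by move=> s; exact: tau_mulr_scalar.
  - exact: tau_nondeg.
  - by move=> a' h h'; rewrite homG_addE homG_scaleE linearP.
  by exists s => h; exact: sE.
have sL k : linear (fun c : ind_mod K U => sval (cid (s_ex k c)) : H^o).
  move=> g c d; apply: (tau_mull_inj tauP) => h.
  rewrite -(svalP (cid (s_ex k _))) mulrDr (tauD tauP) [in RHS]mulrA.
  rewrite -(svalP (cid (s_ex k c))) -(svalP (cid (s_ex k d))).
  by rewrite !linearD; congr (_ + _); rewrite comp_homGE.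
exists b, e, (fun k => sval (linear_pack (sL k))) => c.
apply/eqP; rewrite -subr_eq0; apply/eqP.
apply: (@functionals_separate K C) => l; rewrite linearB [X in _ - X]linear_sum.
apply/eqP; rewrite subr_eq0; apply/eqP.
rewrite -[LHS](evE (l : m) c) aE; apply: eq_bigr => k _.
rewrite -phiE (svalP (cid (s_ex k c))) (svalP (linear_pack (sL k))).
set s := sval (cid _).
have <- : phi k ((s : H^c) *: (l : m)) = (phi k l : H) * s by rewrite linearZ.
rewrite (svalP (cid (tau_phi k))).
exact: comp_lfunE.
Qed.

Lemma equivalent_assertions :
  [<-> F_full K U; T_exact K U; E_eq_B K U; flat (ind_mod K U);
       projective (ind_mod K U)].
Proof.
have flat_fg : flat (ind_mod K U) -> fg_flat by move=> fl m m'; apply: fl.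
tfae.
- by move=> /full_separates/separated_T_exact.
- by move=> /T_exact_flat/fg_flat_full/full_separates/E_eq_B_separated.
- move=> /E_eq_B_separated sep; apply/dual_basis_flat/fg_flat_dual_basis.
  exact/T_exact_flat/separated_T_exact.
- by move=> /flat_fg/fg_flat_dual_basis; exact: dual_basis_projective.
- move=> proj; apply/fg_flat_full/flat_fg/dual_basis_flat.
  exact: (projective_dual_basis (@ind_mod_fg K gT U) proj).
Qed.

End Equivalences.

(** * Where the invariants and the Frobenius form come from *)
Section pGroups.
Variables (K : fieldType) (gT : finGroupType) (U : {group gT}).

(** A p-group acting linearly on a nonzero space in characteristic p fixes a
    nonzero vector; the subrepresentation X is written as a matrix
    representation in a basis. *)
Lemma pgroup_invariants p :
  p \in [pchar K] -> (p.-group U)%g -> invariants_detect K U.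
Proof.
move=> pK pU V X XG X0.
apply/eqP; rewrite -dimv_eq0; apply: contraT; rewrite -lt0n => dX.
pose d := \dim X; pose b : d.-tuple V := vbasis X.
have bX i : b`_i \in X.
  have [ltid|le_di] := ltnP i d; last by rewrite nth_default ?mem0v ?size_tuple.
  by apply/vbasis_mem/mem_nth; rewrite size_tuple.
have bfree : free b by apply: (basis_free (vbasisP X)).
pose vec (r : 'rV[K]_d) : V := \sum_j r 0 j *: b`_j.
have vecX r : vec r \in X by apply: memv_suml => j _; apply: memvZ.
have vec_inj r r' : vec r = vec r' -> r = r'.
  move=> e; apply/rowP => j.
  have := congr1 (coord b j) e.
  by rewrite (coord_sum_free (r 0) _ bfree) (coord_sum_free (r' 0) _ bfree).
have vecL : linear vec.
  move=> a r r'; rewrite scaler_sumr -big_split; apply: eq_bigr => j _ /=.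
  by rewrite !mxE scalerDl scalerA.
have [L LE] := @hom_pack K 'rV[K]_d V vec vecL.
have vec_coord v : v \in X -> vec (\row_j coord b j v) = v.
  by move=> vX; rewrite [RHS](coord_vbasis vX); apply: eq_bigr => j _; rewrite mxE.
(* Matrices act on row vectors on the right, hence the inverse. *)
pose M g : 'M[K]_d := \matrix_(i, j) coord b j (rep_act V g^-1%g b`_i).
have vecM r g : vec (r *m M g) = rep_act V g^-1%g (vec r).
  rewrite -[LHS]LE mulmx_sum_row !linear_sum; apply: eq_bigr => i _.
  rewrite !linearZ /= LE; congr (_ *: _).
  rewrite -[RHS]vec_coord ?XG //; congr vec.
  by apply/rowP => j; rewrite !mxE.
have Mrepr : mx_repr [set: gT] M.
  split=> [|g h _ _]; apply/row_matrixP => i; rewrite !rowE; apply: vec_inj.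
    by rewrite mulmx1 vecM invg1 act_id.
  by rewrite mulmxA !vecM invMg act_actM.
have := rfix_pgroup_pchar pK (MxRepresentation Mrepr) dX pU (subsetT _).
case/rowV0Pn=> r /rfix_mxP rU; apply: contraNT => _.
have vec0 : vec 0 = 0 by apply: big1 => j _; rewrite mxE scale0r.
apply/eqP/vec_inj; rewrite vec0; apply: X0 => //; apply/invariantsP => u Uu.
by rewrite -[u]invgK -vecM rU ?groupV.
Qed.

(** For U the upper unipotent matrices and w the antidiagonal permutation, the
    conjugate of U in the second invariance is the lower unipotent subgroup. *)
Definition double_coset_criterion (w : gT) : Prop :=
  forall f : gT -> K,
    (forall u x, u \in U -> f (u * x)%g = f x) ->
    (forall u x, u \in U -> f (x * u ^ w^-1)%g = f x) ->
    (exists x, f x != 0) ->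
  exists x, f x != 0 /\
    forall v, v \in U -> (x * v)%g \in (U :* x)%g \/ f (x * v)%g = 0.

(** For h nonzero, apply the criterion to the translate by w of the function
    h (1_U), and choose h' with h' (1_U) the characteristic function of
    U x^-1 U. Then tau (h' h) is the sum of h (1_U) over the cosets U \ U x U w,
    in which only the coset of x w contributes. *)
Lemma criterion_frobenius w : double_coset_criterion w ->
  frobenius_form (fun h : hecke K U => vsval (h (charfun K U) : ind_sort K U) w).
Proof.
move=> crit; split.
  by move=> a h h'; rewrite homG_addE homG_scaleE !ffunE.
suff main (h : hecke K U) :
    (forall h' : hecke K U,
       vsval ((h' * h : hecke K U) (charfun K U) : ind_sort K U) w = 0) ->
    h = 0 by exact: main.
move=> h0; apply: hom_ind_ext; rewrite homG_0E; apply: contrapT => /eqP hN0.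
pose fh x := vsval (h (charfun K U) : ind_sort K U) x.
have fhr u x : u \in U -> fh (x * u)%g = fh x.
  move=> Uu; rewrite /fh -ind_actE -hom_intertwines.
  by congr (vsval (h _ : ind_sort K U) x); apply: charfun_invariant.
have fhl u x : u \in U -> fh (u * x)%g = fh x by exact: ind_lmul.
have [||| x [fx xU]] := crit (fun x => fh (x * w)%g).
- by move=> u x Uu; rewrite -mulgA fhl.
- by move=> u x Uu; rewrite conjgE invgK !mulgA mulgKV fhr.
- apply: contrapT => f0; case/eqP: hN0; apply: ind_ext => x; rewrite [RHS]ffunE.
  apply: contrapT => /eqP fx; apply: f0; exists (x * w^-1)%g.
  by rewrite mulgKV.
pose D := (U * [set x^-1] * U)%g.
have DU u y : u \in U -> ((y * u)%g \in D) = (y \in D).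
  move=> Uu; apply/mulsgP/mulsgP => -[a v Da Uv e].
    by exists a (v * u^-1)%g; rewrite ?groupM ?groupV // mulgA -e mulgK.
  by exists a (v * u)%g; rewrite ?groupM // mulgA -e.
have UD u y : u \in U -> ((u * y)%g \in D) = (y \in D).
  rewrite /D -mulgA => Uu; apply/mulsgP/mulsgP => -[v a Uv Da e].
    by exists (u^-1 * v)%g a; rewrite ?groupM ?groupV // -mulgA -e mulKg.
  by exists (u * v)%g a; rewrite ?groupM // -mulgA -e.
have DP : [ffun y => (y \in D)%:R : K^o] \in ind_space K U.
  by apply/ind_spaceP => u y Uu; rewrite !ffunE UD.
have [|h' h'E] := @frobenius_reciprocity K gT U (ind K U) (Subvs DP : ind_sort K U).
  apply/invariantsP => u Uu; apply: ind_ext => y.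
  by rewrite ind_actE !ffunE DU.
case/eqP: fx; have := h0 h'; rewrite comp_homGE.
rewrite [h _](ind_decomp (h (charfun K U) : ind_sort K U)) linear_sum.
have term y :
    vsval (h' (fh y *: ind_act K U y^-1%g (charfun K U)) : ind_sort K U) w =
    fh y * (w * y^-1 \in D)%g%:R.
  rewrite linearZ /= ffunE [h' _](hom_intertwines h') h'E.
  by rewrite ind_actE ffunE.
pose y0 := fingroup.repr (U :* (x * w))%g.
have [u Uu y0E] : exists2 u, u \in U & y0 = (u * (x * w))%g.
  by rewrite /y0; case: repr_rcosetP => u Uu; exists u.
have y0K : fingroup.repr (U :* y0)%g = y0.
  by rewrite y0E rcosetM (rcoset_id Uu).
rewrite [vsval _]linear_sum sum_ffunE (bigD1 y0) /=; last by rewrite y0K.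
rewrite term big1 => [|y /andP[/eqP yE yy0]].
  have -> : (w * y0^-1)%g \in D.
    rewrite y0E !invMg !mulgA mulgV mul1g DU ?groupV //.
    by rewrite -[(x^-1)%g]mul1g -[(1 * _)%g]mulg1 !mem_mulg ?set11.
  by rewrite mulr1 addr0 y0E fhl.
rewrite term; case: (boolP (_ \in D)) => [|_]; last by rewrite mulr0.
case/mulsgP=> _ u2 /rcosetP[u1 Uu1 ->] Uu2 /(canRL (mulKg _))/(canRL invgK).
rewrite !invMg !invgK => yE'.
have {}yE' : y = (u2^-1 * (x * u1^-1) * w)%g by rewrite yE' !mulgA.
have [xv|f0] := xU u1^-1%g (groupVr Uu1); last first.
  by rewrite yE' -!mulgA fhl ?groupV // !mulgA f0 mul0r.
case/eqP: yy0; rewrite yE /y0; congr fingroup.repr; rewrite yE'.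
case/rcosetP: xv => u3 Uu3 ->.
by rewrite -!mulgA rcosetM (rcoset_id (groupVr Uu2)) rcosetM (rcoset_id Uu3).
Qed.

End pGroups.

(** * The Birkhoff decomposition of invertible matrices *)
Section UnipotentMatrices.
Variables (n : nat) (k : fieldType).
Implicit Types A B P v : 'M[k]_n.

Definition upper_unipotent A :=
  forall i j : 'I_n, (j <= i)%N -> A i j = (i == j)%:R.

Definition lower_unipotent A :=
  forall i j : 'I_n, (i <= j)%N -> A i j = (i == j)%:R.

Lemma lower_unipotent_unit A : lower_unipotent A -> A \in unitmx.
Proof.
move=> AU; rewrite unitmxE det_trig.
  by rewrite big1 ?unitr1 // => i _; rewrite AU // eqxx.
apply/is_trig_mxP => i j ij; rewrite AU ?(ltnW ij) //.
by case: eqP ij => // ->; rewrite ltnn.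
Qed.

Lemma upper_unipotent_unit A : upper_unipotent A -> A \in unitmx.
Proof.
move=> AU; rewrite -unitmx_tr; apply: lower_unipotent_unit => i j ij.
by rewrite mxE AU // eq_sym.
Qed.

Lemma upper_unipotentM A B :
  upper_unipotent A -> upper_unipotent B -> upper_unipotent (A *m B).
Proof.
move=> AU BU i j ji; rewrite mxE (bigD1 i) //= AU // eqxx mul1r BU //.
rewrite big1 ?addr0 // => l li; have [le|lt] := leqP l i.
  by rewrite AU // eq_sym (negPf li) mul0r.
rewrite BU ?(leq_trans ji (ltnW lt)) //; case: eqP => [e|]; last by rewrite mulr0.
by move: ji; rewrite -e leqNgt lt.
Qed.

Lemma lower_unipotentM A B :
  lower_unipotent A -> lower_unipotent B -> lower_unipotent (A *m B).
Proof.
have trU C : lower_unipotent C -> upper_unipotent C^T.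
  by move=> CU i j ji; rewrite mxE CU // eq_sym.
move=> /trU AU /trU BU i j ij.
have := upper_unipotentM BU AU ij; rewrite -trmx_mul mxE => ->.
by rewrite eq_sym.
Qed.

Lemma outer_mulE (c : 'cV[k]_n) (r : 'rV[k]_n) a b :
  (c *m r) a b = c a 0 * r 0 b.
Proof. by rewrite mxE big_ord1. Qed.

(** The rows of index at least s are monomial: row l has its only nonzero entry
    in column sigma l, and that column has no other nonzero entry. For s = 0 the
    matrix is monomial. *)
Definition cleared (sigma : 'I_n -> 'I_n) (s : nat) P : Prop :=
  forall l : 'I_n, (s <= l)%N ->
    [/\ P l (sigma l) != 0, forall j, j != sigma l -> P l j = 0
      & forall a, a != l -> P a (sigma l) = 0].

(** One elimination step, from the bottom row up. The pivot is the last nonzero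
    entry of row i: the columns to its left can be cleared by U^- on the right,
    and the rows above it by U on the left. *)
Lemma clear_row sigma (i : 'I_n) Y : cleared sigma i.+1 Y -> Y \in unitmx ->
  exists tau E L Z, [/\ upper_unipotent E, lower_unipotent L,
    E *m Y = Z *m L & cleared tau i Z].
Proof.
move=> Yc Yu.
have [j0 Yij0] : exists j, Y i j != 0.
  apply: contrapT => Yi0; have rY : row i Y = 0.
    apply/rowP => j; rewrite !mxE; apply: contrapT => /eqP Yij.
    by apply: Yi0; exists j.
  have /rowP/(_ i) : row i (Y *m invmx Y) = 0 by rewrite row_mul rY mul0mx.
  by rewrite mulmxV // !mxE eqxx => /eqP; rewrite oner_eq0.
have [j Yij jmax] :
    exists2 j, Y i j != 0 & forall b : 'I_n, (j < b)%N -> Y i b = 0.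
  case: (@arg_maxnP _ j0 (fun j => Y i j != 0) (fun j => val j) Yij0).
  move=> j Yij jmax; exists j => // b jb.
  by apply: contrapT => /eqP /jmax; rewrite /= leqNgt jb.
have sig_j (l : 'I_n) : (i < l)%N -> j != sigma l.
  move=> il; have [_ _ col0] := Yc l il.
  apply: contraNneq Yij => ->; rewrite col0 //.
  by apply: contraTneq il => ->; rewrite ltnn.
(* Subtracting multiples of row i from the rows above it empties column j
   outside row i. Only then are multiples of column j, now a multiple of a unit
   vector, subtracted from the columns on its left; this changes row i alone. *)
pose c : 'cV[k]_n := \col_a (if (a < i)%N then Y a j / Y i j else 0).
pose r : 'rV[k]_n := \row_b (if (b < j)%N then Y i b / Y i j else 0).
pose E := 1%:M - c *m delta_mx 0 i.
pose L := 1%:M + delta_mx j 0 *m r.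
pose Z : 'M[k]_n := \matrix_(a, b) if a == i then Y i b *+ (b == j)
  else Y a b - c a 0 * Y i b.
have EE a b : E a b = (a == b)%:R - c a 0 * (b == i)%:R.
  by rewrite !mxE big_ord1 !mxE eqxx.
have LE a b : L a b = (a == b)%:R + (a == j)%:R * r 0 b.
  by rewrite !mxE big_ord1 !mxE eqxx andbT.
have Zi b : Z i b = Y i b *+ (b == j) by rewrite mxE eqxx.
have Zj a : a != i -> Z a j = 0.
  move=> ai; rewrite !mxE (negPf ai); have [lt_ai|le_ia] := ltnP a i.
    by rewrite divfK ?subrr.
  rewrite mul0r subr0; have il : (i < a)%N by rewrite ltn_neqAle le_ia eq_sym ai.
  by have [_ -> //] := Yc a il; apply: sig_j.
exists (fun l => if l == i then j else sigma l), E, L, Z; split.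
- move=> a b ba; rewrite EE; case: (b =P i) => [bi|_]; last by rewrite mulr0 subr0.
  by rewrite mxE ltnNge -bi ba mul0r subr0.
- move=> a b ab; rewrite LE; case: (a =P j) => [aj|_]; last by rewrite mul0r addr0.
  by rewrite mxE ltnNge -aj ab mulr0 addr0.
- apply/matrixP => a b; rewrite /E /L mulmxBl mul1mx mulmxDr mulmx1 -mulmxA -rowE.
  rewrite mulmxA -colE.
  have -> : (Y - c *m row i Y) a b = Y a b - c a 0 * Y i b.
    by rewrite [LHS]mxE [X in _ + X]mxE outer_mulE [row i Y 0 b]mxE.
  have -> : (Z + col j Z *m r) a b = Z a b + Z a j * r 0 b.
    by rewrite [LHS]mxE outer_mulE [col j Z a 0]mxE.
  case: (a =P i) => [->|/eqP ai]; last first.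
    by rewrite Zj // mul0r addr0 [Z a b]mxE (negPf ai).
  rewrite !Zi eqxx mulr1n [c i 0]mxE ltnn mul0r subr0 [r 0 b]mxE.
  have [bj|jb|/val_inj->] := ltngtP b j.
  + have -> : (b == j) = false by apply: contraTF bj => /eqP->; rewrite ltnn.
    by rewrite mulr0n add0r mulrC divfK.
  + by rewrite jmax // mul0rn mulr0 addr0.
  + by rewrite eqxx mulr1n mulr0 addr0.
move=> l il; case: (l =P i) => [->|/eqP li].
  split=> [|b bj|a ai]; last exact: Zj.
    by rewrite mxE !eqxx mulr1n.
  by rewrite mxE eqxx (negPf bj).
have {}il : (i < l)%N by rewrite ltn_neqAle eq_sym li.
have cl0 : c l 0 = 0 by rewrite mxE ltnNge ltnW.
have [Yls row0 col0] := Yc l il.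
have Yis : Y i (sigma l) = 0 by rewrite col0 // eq_sym.
split=> [|b bs|a al].
- by rewrite mxE (negPf li) cl0 mul0r subr0.
- by rewrite mxE (negPf li) cl0 mul0r subr0 row0.
rewrite mxE Yis mulr0 mul0rn col0 // subr0.
by case: ifP.
Qed.

Lemma birkhoff X : X \in unitmx ->
  exists sigma A P B, [/\ upper_unipotent A, lower_unipotent B,
    A *m X = P *m B & cleared sigma 0 P].
Proof.
move=> Xu.
suff H d : exists sigma A P B, [/\ upper_unipotent A, lower_unipotent B,
    A *m X = P *m B & cleared sigma (n - d) P].
  by have := H n; rewrite subnn.
elim: d => [|d [sigma [A [P [B [AU BL e Pc]]]]]].
  exists id, 1%:M, X, 1%:M; split; rewrite ?mulmx1 ?mul1mx //.
  - by move=> i j _; rewrite mxE.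
  - by move=> i j _; rewrite mxE.
  - by move=> l; rewrite subn0 leqNgt ltn_ord.
have [nd|dn] := leqP n d.
  exists sigma, A, P, B; split=> //.
  by move: Pc; rewrite (eqP nd); rewrite (eqP (leqW nd : n <= d.+1)%N).
have lt_in : (n - d.+1 < n)%N by rewrite ltn_subrL (leq_trans _ dn).
pose i := Ordinal lt_in.
have Pu : P \in unitmx.
  have : A *m X \in unitmx by rewrite unitmx_mul upper_unipotent_unit.
  by rewrite e unitmx_mul => /andP[].
have iS : (n - d = i.+1)%N by rewrite /= subnSK.
rewrite iS in Pc.
have [tau [E [L [Z [EU LL eZ Zc]]]]] := clear_row Pc Pu.
exists tau, (E *m A), Z, (L *m B); split=> //.
- exact: upper_unipotentM.
- exact: lower_unipotentM.
- by rewrite -mulmxA e !mulmxA eZ.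
Qed.

Lemma cleared_inj sigma P : cleared sigma 0 P -> injective sigma.
Proof.
move=> Pc a b sab; have [Pa _ _] := Pc a isT; have [_ _ col0] := Pc b isT.
by apply/eqP; apply: contraNT Pa => /col0; rewrite -sab => ->; rewrite eqxx.
Qed.

(** * Upper unipotent translates of monomial matrices *)
Section Compare.
Variables (sigma sigma' : 'I_n -> 'I_n) (P P' v A B : 'M[k]_n).
(** For v in U, the translate P v of a monomial matrix lies in U P' U^-, with P'
    monomial. Reading rows from the bottom, the first i at which sigma and
    sigma' differ satisfies sigma i < sigma' i, and if they agree then P v lies
    in U P. *)
Hypotheses (Pc : cleared sigma 0 P) (Pc' : cleared sigma' 0 P').
Hypotheses (vU : upper_unipotent v) (AU : upper_unipotent A).
Hypotheses (BL : lower_unipotent B) (eAB : A *m (P *m v) = P' *m B).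

(** Row l of P v is supported on the pivot columns of P of rows l and below. *)
Let supported_row (l : 'I_n) :=
  forall b, (forall l' : 'I_n, (l <= l')%N -> b != sigma l') ->
  v (sigma l) b = 0.

Let mono_mul s Q M (l b : 'I_n) :
  cleared s 0 Q -> (Q *m M) l b = Q l (s l) * M (s l) b.
Proof.
move=> Qc; have [_ row0 _] := Qc l isT.
by rewrite mxE (bigD1 (s l)) //= big1 ?addr0 // => j /row0->; rewrite mul0r.
Qed.

(** Both sides are the entry (i, b) of A P v = P' B, provided that the rows of
    P v below row i vanish in column b. *)
Let entry (i b : 'I_n) : (forall l : 'I_n, (i < l)%N -> v (sigma l) b = 0) ->
  P' i (sigma' i) * B (sigma' i) b = P i (sigma i) * v (sigma i) b.
Proof.
move=> v0; rewrite -(mono_mul B i b Pc') -eAB mxE (bigD1 i) //= AU // eqxx mul1r.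
rewrite big1 ?addr0 => [|l li]; first exact: mono_mul.
rewrite (mono_mul v l b Pc); have [il|le] := ltnP i l.
  by rewrite v0 // !mulr0.
by rewrite AU // eq_sym (negPf li) mul0r.
Qed.

Let supported_later (i : 'I_n) :
    (forall l : 'I_n, (i < l)%N -> supported_row l) ->
  forall b, (forall l' : 'I_n, (i < l')%N -> b != sigma l') ->
  forall l : 'I_n, (i < l)%N -> v (sigma l) b = 0.
Proof.
move=> ok b bs l il; apply: ok => // l' ll'; apply: bs.
exact: leq_trans ll'.
Qed.

(** The entry of A P v in row i and column sigma i is a pivot of P, since the
    rows below it vanish there; but row i of P' B is supported on the columns
    up to sigma' i. *)
Lemma compare_step (i : 'I_n) :
    (forall l : 'I_n, (i < l)%N -> supported_row l) ->
  (sigma i <= sigma' i)%N.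
Proof.
move=> ok; rewrite leqNgt; apply/negP => lt.
have e : P' i (sigma' i) * B (sigma' i) (sigma i) =
    P i (sigma i) * v (sigma i) (sigma i).
  apply/entry/supported_later => // l il.
  by apply: contraTneq il => /(cleared_inj Pc)->; rewrite ltnn.
have [Pi _ _] := @Pc i isT.
have B0 : B (sigma' i) (sigma i) = 0.
  rewrite (BL (ltnW lt)).
  have -> : (sigma' i == sigma i) = false; last by [].
  by apply: contraTF lt => /eqP->; rewrite ltnn.
have v1 : v (sigma i) (sigma i) = 1 by rewrite (vU (leqnn _)) eqxx.
by case/negP: Pi; rewrite -[P i _]mulr1 -v1 -e B0 mulr0.
Qed.

(** Same comparison, now in the columns beyond sigma i = sigma' i that are not
    pivot columns of lower rows: row i of P' B vanishes there, and it coincides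
    there with row i of P v. *)
Lemma compare_supported (i : 'I_n) :
  (forall l : 'I_n, (i <= l)%N -> sigma' l = sigma l) -> supported_row i.
Proof.
have [d] := ubnP (n - i); elim: d i => // d IH i; rewrite ltnS => di ss b bs.
have ok (l : 'I_n) : (i < l)%N -> supported_row l.
  move=> il; apply: IH => [|l' ll']; last by apply: ss; rewrite ltnW // (leq_trans il).
  by apply: leq_trans di; rewrite ltn_sub2l.
have [lt|gt|/val_inj e] := ltngtP b (sigma i).
- by rewrite (vU (ltnW lt)); case: eqP lt => // ->; rewrite ltnn.
- have [Pi _ _] := @Pc i isT; apply: (mulfI Pi); rewrite mulr0 -entry.
    rewrite (ss i (leqnn i)) (BL (ltnW gt)).
    case: eqP gt => [->|_ _]; first by rewrite ltnn.
    by rewrite mulr0.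
  by apply: supported_later ok _ (fun l' il' => bs l' (ltnW il')).
- by have := bs i (leqnn i); rewrite e eqxx.
Qed.

Lemma compare_eq : sigma' =1 sigma ->
  exists2 C, upper_unipotent C & P *m v = C *m P.
Proof.
move=> ss; have ok i : supported_row i by apply: compare_supported => l _.
have sI := cleared_inj Pc.
exists (\matrix_(a, b) (P a (sigma a) * v (sigma a) (sigma b) / P b (sigma b))).
  move=> a b ba; rewrite mxE; have [Pa _ _] := @Pc a isT.
  case: (a =P b) => [<-|/eqP ab]; first by rewrite (vU (leqnn _)) eqxx mulr1 divff.
  rewrite ok ?mulr0 ?mul0r // => l' al'; rewrite (inj_eq sI).
  apply: contraNneq ab => bl; move: al'; rewrite -bl => ab.
  by apply/eqP/val_inj/eqP; rewrite eqn_leq ab ba.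
apply/matrixP => a c; have [b ->] : exists b, c = sigma b.
  by have [g _ gK] := injF_bij sI; exists (g c); rewrite gK.
rewrite (mono_mul v a (sigma b) Pc) mxE (bigD1 b) //= big1 ?addr0 => [|d db].
  by have [Pb _ _] := @Pc b isT; rewrite mxE divfK.
by have [_ _ col0] := @Pc b isT; rewrite col0 ?mulr0.
Qed.

End Compare.
End UnipotentMatrices.

(** * The general linear group *)
Section GL.
Variables (n : nat) (k : finFieldType).
Local Notation N := n.-1.+1.

Lemma unitriP (g : {'GL_n[k]}) :
  reflect (upper_unipotent (GLval g)) (g \in unitri n k).
Proof.
rewrite inE; apply: (iffP forallP) => [gU i j ji|gU i].
  by have /forallP/(_ j)/implyP/(_ ji)/eqP := gU i.
by apply/forallP => j; apply/implyP => ji; apply/eqP/gU.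
Qed.

Lemma GL_lift (A : 'M[k]_N) :
  A \in unitmx -> exists g : {'GL_n[k]}, GLval g = A.
Proof. by move=> Au; exists (FinRing.Unit Au). Qed.

Lemma GLval_inj : injective (@GLval n k).
Proof. exact: val_inj. Qed.

(** A = 1 + D with D strictly upper triangular, and raising to the power p^N is
    additive on 1 and D. *)
Lemma unipotent_pchar (p : nat) (A : 'M[k]_N) : p \in [pchar k] ->
  upper_unipotent A -> A ^+ (p ^ N)%N = 1.
Proof.
move=> pk AU; have pM : p \in [pchar 'M[k]_N] by rewrite (pchar_lalg 'M[k]_N).
pose D := A - 1.
have D0 (i j : 'I_N) : (j <= i)%N -> D i j = 0.
  by move=> ji; rewrite !mxE AU // subrr.
have Dm m : forall i j : 'I_N, (j < i + m)%N -> (D ^+ m) i j = 0.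
  elim: m => [|m IH] i j ji.
    by rewrite expr0 mxE; case: eqP ji => // ->; rewrite addn0 ltnn.
  rewrite exprS mxE big1 // => l _; have [li|il] := leqP l i.
    by rewrite D0 // mul0r.
  by rewrite IH ?mulr0 //; apply: (leq_trans ji); rewrite addnS -addSn leq_add2r.
have Dnil : D ^+ (p ^ N)%N = 0.
  apply/matrixP => i j; rewrite mxE Dm // (leq_trans (ltn_ord j)) //.
  rewrite (leq_trans _ (leq_addl _ _)) // ltnW // ltn_expl //.
  exact: prime_gt1 (pcharf_prime pk).
have Frob e : (1 + D) ^+ (p ^ e)%N = 1 + D ^+ (p ^ e)%N.
  elim: e => [|e IH]; first by rewrite !expn0 !expr1.
  rewrite expnSr !exprM IH -!(pFrobenius_autE pM) pFrobenius_autD_comm.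
    by rewrite pFrobenius_aut1.
  exact/commr_sym/commr1.
by rewrite -[A](subrK 1) addrC Frob Dnil addr0.
Qed.

Lemma unitri_pgroup p : p \in [pchar k] -> (p.-group (unitri n k))%g.
Proof.
move=> pk; apply/pgroupP => q q_pr /(Cauchy q_pr)[g gU og].
have gX (m : nat) : GLval (g ^+ m)%g = GLval g ^+ m.
  elim: m => [|m IH]; first by exact: GL_1E.
  by rewrite expgS [LHS]GL_MxE IH exprS.
have : (g ^+ (p ^ N))%g == 1%g.
  by apply/eqP/GLval_inj; rewrite gX unipotent_pchar //; exact/unitriP.
rewrite -order_dvdn og Euclid_dvdX // => /andP[].
by rewrite dvdn_prime2 // (pcharf_prime pk).
Qed.

(** Among the monomial matrices where f does not vanish, take x whose
    permutation, read from the bottom row, is lexicographically maximal. If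
    f (x v) != 0, reducing x v to a monomial matrix y gives f y != 0, and the
    permutation of y is at least that of x by [compare_step]; so both agree,
    and x v lies in U x by [compare_eq]. *)
Lemma unitri_criterion (K : fieldType) :
  exists w, double_coset_criterion K (unitri_group n k) w.
Proof.
pose s := perm (@rev_ord_inj N).
have [w wE] := GL_lift (unitmx_perm k s).
have wV : GLval w^-1%g = perm_mx s^-1%g by rewrite [RHS]perm_mxV GL_VxE wE.
exists w => f fl fr [x0 fx0].
have flM (x y : {'GL_n[k]}) A :
    upper_unipotent A -> GLval y = A *m GLval x -> f y = f x.
  move=> AU yE; have [u uE] := GL_lift (upper_unipotent_unit AU).
  have -> : y = (u * x)%g by apply: GLval_inj; rewrite GL_MxE uE.
  by apply: fl; apply/unitriP; rewrite uE.
have frM (x y : {'GL_n[k]}) B :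
    lower_unipotent B -> GLval y = GLval x *m B -> f y = f x.
  move=> BL yE; pose B' := col_perm s (row_perm s B).
  have B'U : upper_unipotent B'.
    move=> i j ji; rewrite !mxE BL.
      by rewrite (inj_eq perm_inj).
    by rewrite !permE /= leq_sub2l.
  have [u uE] := GL_lift (upper_unipotent_unit B'U).
  have -> : y = (x * u ^ w^-1)%g.
    apply: GLval_inj; rewrite conjgE invgK !GL_MxE wV wE uE yE; congr (_ *m _).
    rewrite -row_permE -col_permE; apply/matrixP => i j.
    by rewrite !mxE !permE /= !rev_ordK.
  by apply: fr; apply/unitriP; rewrite uE.
have reduce x : f x != 0 -> exists sigma A B (y : {'GL_n[k]}),
    [/\ upper_unipotent A, lower_unipotent B,
        A *m GLval x = GLval y *m B, cleared sigma 0 (GLval y) & f y != 0].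
  move=> fx; have [sigma [A [P [B [AU BL e Pc]]]]] := birkhoff (GL_unitmx x).
  have Axu : A *m GLval x \in unitmx.
    by rewrite unitmx_mul upper_unipotent_unit // GL_unitmx.
  have [z zE] := GL_lift Axu.
  move: Axu; rewrite e unitmx_mul => /andP[/GL_lift[y yE] _].
  exists sigma, A, B, y; rewrite yE; split=> //.
  by rewrite -(frM y z B BL) ?zE ?yE // (flM x z A AU zE).
pose sg (y : {'GL_n[k]}) : {ffun 'I_N -> 'I_N} :=
  [ffun i => odflt ord0 [pick j | GLval y i j != 0]].
have sgE y sigma : cleared sigma 0 (GLval y) -> sg y =1 sigma.
  move=> yc i; have [yi row0 _] := @yc i isT; rewrite ffunE.
  case: pickP => [j /= yij|/(_ (sigma i))]; last by rewrite yi.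
  by apply/eqP; apply: contraNT yij => /row0->.
(* Rows are reversed, as the bottom row is the most significant one. *)
pose code y : N.-tuplelexi 'I_N := [tuple sg y (rev_ord i) | i < N].
pose good (y : {'GL_n[k]}) :=
  (f y != 0) && `[< exists sigma, cleared sigma 0 (GLval y) >].
have [sigma0 [_ [_ [y0 [_ _ _ y0c fy0]]]]] := reduce _ fx0.
have good0 : good y0 by rewrite /good fy0; apply/asboolP; exists sigma0.
case: (@Order.TotalTheory.arg_maxP _ _ _ _ good code good0) => x.
move=> /andP[fx /asboolP[sigma xc]] xmax; exists x; split=> // v /unitriP vU.
have [->|/eqP fxv] := eqVneq (f (x * v)%g) 0; first by right.
left.
have [sigma' [A [B [y [AU BL e yc fy]]]]] := reduce _ (introN eqP fxv).
rewrite GL_MxE in e.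
have ylex : (code y <= code x)%O.
  by apply: xmax; rewrite /good fy; apply/asboolP; exists sigma'.
have ss (d : nat) : forall i : 'I_N, (N - d <= i)%N -> sigma' i = sigma i.
  elim: d => [|d IH] i; first by rewrite subn0 leqNgt ltn_ord.
  move=> di; have supported_later (l : 'I_N) : (i < l)%N -> sigma' l = sigma l.
    move=> il; apply: IH; move: di; rewrite !leq_subLR => /leq_trans; apply.
    by rewrite addSnnS leq_add2l.
  have le : (sigma i <= sigma' i)%N.
    apply: (compare_step xc yc vU AU BL e) => l il.
    apply: (compare_supported xc yc vU AU BL e) => l' ll'.
    by apply: supported_later; apply: leq_trans ll'.
  apply: val_inj; apply/eqP; rewrite eqn_leq le andbT leqNgt; apply/negP => lt.
  suff : (code x < code y)%O by move/Order.POrderTheory.lt_geF; rewrite ylex.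
  apply/ltxi_tuplePlt; exists (rev_ord i) => [j ji|]; rewrite !tnth_mktuple.
    rewrite (sgE _ _ xc) (sgE _ _ yc) supported_later //.
    by move: ji; rewrite /= !ltn_subRL addSn addnC -addSn.
  by rewrite (sgE _ _ xc) (sgE _ _ yc) rev_ordK.
have [|C CU xvE] := compare_eq xc yc vU AU BL e.
  by move=> i; apply: (ss N); rewrite subnn.
apply/rcosetP; have [u uE] := GL_lift (upper_unipotent_unit CU).
exists u; first by apply/unitriP; rewrite uE.
by apply: GLval_inj; rewrite !GL_MxE uE.
Qed.

End GL.

Theorem proposition1p18 (p n : nat) (k : finFieldType)
    (K : closedFieldType) (iota : {rmorphism k -> K})
    (char_k : p \in [pchar k]) (n_gt0 : (0 < n)%N)
    (K_algebraic : forall x : K, algebraicOver iota x) :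
  [<-> F_full K (unitri_group n k);
       T_exact K (unitri_group n k);
       E_eq_B K (unitri_group n k);
       @flat (hecke K (unitri_group n k)) (ind_mod K (unitri_group n k));
       @projective (hecke K (unitri_group n k)) (ind_mod K (unitri_group n k))].
Proof.
have [w crit] := unitri_criterion n k K.
have detectP : invariants_detect K (unitri_group n k).
  exact: pgroup_invariants (rmorph_pchar iota char_k) (unitri_pgroup n char_k).
exact: (equivalent_assertions detectP (criterion_frobenius crit)).
Qed.
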